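(* Let $n\ge 3$. The number of equivalence classes of semirigid $3$-nilpotent semigroups of cardinality $n$ is at most $$E_n=\sum_{r=1}^{n-2}\ \sum_{\lambda\vdash r}\frac{\left\{ {\beta(\lambda)+1 \atop n-r} \right\}+\sum_{j=0}^{\zeta(\lambda)}\binom{\zeta(\lambda)}{j}\sum_{t=0}^{\min\{j,\lfloor (n-r-1)/2\rfloor\}} a_{j,t}\left\{ {\zeta(\lambda)+\eta(\lambda)-j+1 \atop n-r-2t} \right\}}{2\,w(\lambda)},$$ and $E_n$ is also at most the number of equivalence classes of all $3$-nilpotent semigroups of cardinality $n$.
   Context: A semigroup $S$ is $3$-nilpotent if it is finite, has a zero $0$, satisfies $xyz=0$ for all $x,y,z$, and $ab\ne0$ for some $a,b$. $S$ is semirigid if every automorphism of $S$ fixes every element of $S^2$. The dual $S^*$ of $S$ has product $x*y=yx$; two semigroups $S_1,S_2$ are equivalent if $S_1\cong S_2$ or $S_1^*\cong S_2$ (isomorphic or anti-isomorphic). $\left\{ {a \atop b} \right\}$ is the Stirling number of the second kind, with $\left\{ {0 \atop 0} \right\}=1$ and value $0$ if $b>a$ or ($b=0<a$). $a_{j,t}=2^{j-t}\left\{ {j \atop t} \right\}$. For $\lambda\vdash r$ with parts listed with repetition as $\lambda_1,\dots,\lambda_s$: $\beta(\lambda)=\sum_{i,j=1}^{s}\gcd(\lambda_i,\lambda_j)$; $e_i=1$ if $\lambda_i$ is even, else $0$; $f_i=1$ if $\lambda_i\equiv2\pmod4$, else $0$; $e_{ij}=1$ if at least one of $\lambda_i,\lambda_j$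 is even, else $0$; $$\zeta(\lambda)=\tfrac12\sum_{i=1}^{s}\big((1+e_i)(\lambda_i+1)-2(f_i+1)\big)+\sum_{1\le i<j\le s}(1+e_{ij})\gcd(\lambda_i,\lambda_j),\qquad \eta(\lambda)=\sum_{i=1}^{s}(1-e_i+2f_i).$$ If the distinct part sizes are $\ell_1,\dots,\ell_q$ with multiplicities $\mu_1,\dots,\mu_q$, $w(\lambda)=\ell_1^{\mu_1}\cdots\ell_q^{\mu_q}\mu_1!\cdots\mu_q!$. *)

(* Defs.v *)
From HB Require Import structures.
From mathcomp Require Import all_boot all_order all_algebra all_fingroup.
From mathcomp Require Import zify ring lra.

Set Implicit Arguments.
Unset Strict Implicit.
Unset Printing Implicit Defensive.

Import Order.TTheory GRing.Theory Num.Theory.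

Section Semigroups.

Variable T : finType.

Definition binop := {ffun T -> {ffun T -> T}}.

Implicit Types (S : binop) (x y z : T).

Definition semigroup S :=
  [forall x, forall y, forall z, S x (S y z) == S (S x y) z].

Definition is_zero S z := [forall x, (S z x == z) && (S x z == z)].

Definition nilpotent3 S :=
  semigroup S &&
  [exists o, [&& is_zero S o,
                 [forall x, forall y, forall z, S (S x y) z == o]
               & [exists a, exists b, S a b != o]]].

Definition iso_by (f : {perm T}) S1 S2 :=
  [forall x, forall y, f (S1 x y) == S2 (f x) (f y)].

Definition isomorphic S1 S2 := [exists f : {perm T}, iso_by f S1 S2].

Definition semirigid S :=
  [forall f : {perm T}, iso_by f S S ==> [forall x, forall y, f (S x y) == S x y]].

Definition dual S : binop := [ffun x => [ffun y => S y x]].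

Definition sg_equiv S1 S2 := isomorphic S1 S2 || isomorphic (dual S1) S2.

Lemma iso_byP (f : {perm T}) S1 S2 :
  reflect (forall x y, f (S1 x y) = S2 (f x) (f y)) (iso_by f S1 S2).
Proof.
apply: (iffP forallP) => [h x y|h x]; first by move/forallP: (h x) => /(_ y)/eqP.
by apply/forallP => y; rewrite h.
Qed.

Lemma isomorphic_refl S : isomorphic S S.
Proof. by apply/existsP; exists 1%g; apply/iso_byP => x y; rewrite !perm1. Qed.

Lemma isomorphic_sym S1 S2 : isomorphic S1 S2 -> isomorphic S2 S1.
Proof.
case/existsP=> f /iso_byP h; apply/existsP; exists (f^-1)%g; apply/iso_byP=> x y.
by apply: (@perm_inj _ f); rewrite h !permKV.
Qed.

Lemma isomorphic_trans S1 S2 S3 :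
  isomorphic S1 S2 -> isomorphic S2 S3 -> isomorphic S1 S3.
Proof.
case/existsP=> f /iso_byP hf /existsP[g /iso_byP hg].
by apply/existsP; exists (f * g)%g; apply/iso_byP=> x y; rewrite !permM hf hg.
Qed.

Lemma isomorphic_dual S1 S2 :
  isomorphic S1 S2 -> isomorphic (dual S1) (dual S2).
Proof.
case/existsP=> f /iso_byP h; apply/existsP; exists f; apply/iso_byP=> x y.
by rewrite !ffunE h.
Qed.

Lemma dualK : involutive dual.
Proof. by move=> S; apply/ffunP => x; apply/ffunP => y; rewrite !ffunE. Qed.

Lemma sg_equiv_equivalence : equivalence_rel sg_equiv.
Proof.
apply/equivalence_relP; split=> [S|]; first by rewrite /sg_equiv isomorphic_refl.
have sym S1 S2 : sg_equiv S1 S2 -> sg_equiv S2 S1.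
  case/orP=> [/isomorphic_sym h|/isomorphic_dual]; first by rewrite /sg_equiv h.
  by rewrite dualK => /isomorphic_sym h; rewrite /sg_equiv h orbT.
have trans S1 S2 S3 : sg_equiv S1 S2 -> sg_equiv S2 S3 -> sg_equiv S1 S3.
  case/orP=> h1 /orP[] h2; rewrite /sg_equiv.
  - by rewrite (isomorphic_trans h1 h2).
  - by rewrite (isomorphic_trans (isomorphic_dual h1) h2) orbT.
  - by rewrite (isomorphic_trans h1 h2) orbT.
  - move/isomorphic_dual: h1; rewrite dualK => h1.
    by rewrite (isomorphic_trans h1 h2).
move=> S1 S2 h S3; apply/idP/idP; first exact/trans/sym.
exact: trans.
Qed.

End Semigroups.

(* Every semigroup with n elements is isomorphic to one with carrier 'I_n. *)
Definition num_classes n (P : pred (binop 'I_n)) : nat :=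
  #|equivalence_partition (@sg_equiv 'I_n) [set S | P S]|.

Definition stirling2 (a b : nat) : nat :=
  #|[set P : {set {set 'I_a}} | partition P [set: 'I_a] & #|P| == b]|.

Definition acoef (j t : nat) : nat := 2 ^ (j - t) * stirling2 j t.

Definition is_partition (r : nat) (lam : seq nat) :=
  [&& sorted geq lam, all (fun k => 0 < k) lam & sumn lam == r].

(* A partition of r has at most r parts, each at most r. It is coded by the
   r-tuple of its parts in nonincreasing order, padded with zeros. *)
Definition partitions (r : nat) : seq (seq nat) :=
  [seq lam <- undup [seq [seq val k | k <- t & 0 < val k]
                    | t : r.-tuple 'I_r.+1] | is_partition r lam].

Lemma partitions_uniq r : uniq (partitions r).
Proof. exact/filter_uniq/undup_uniq. Qed.

Lemma mem_partitions r lam : (lam \in partitions r) = is_partition r lam.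
Proof.
rewrite mem_filter mem_undup; case: (boolP (is_partition r lam)) => //=.
case/and3P=> _ /allP pos /eqP sum.
have szr : size lam <= r.
  rewrite -sum; elim: lam pos {sum} => //= k s IH pos.
  have := pos k (mem_head _ _).
  have := IH (fun x xs => pos x (mem_behead (s := k :: s) xs)); lia.
have ler k : k \in lam -> k < r.+1.
  rewrite -sum ltnS; elim: lam {pos sum szr} => //= x s IH.
  by rewrite inE => /orP[/eqP->|/IH]; lia.
pose u : seq 'I_r.+1 := map inord lam ++ nseq (r - size lam) ord0.
have szu : size u == r by rewrite size_cat size_map size_nseq subnKC.
apply/imageP; exists (Tuple szu) => //=.
rewrite /u filter_cat map_cat.
have -> : [seq k <- nseq (r - size lam) (ord0 : 'I_r.+1) | 0 < val k] = [::].
  by rewrite filter_nseq.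
rewrite cats0 filter_map -map_comp.
have -> : [seq k <- lam | preim inord (fun k : 'I_r.+1 => 0 < val k) k] = lam.
  apply/all_filterP/allP => k kl /=.
  by rewrite inordK ?pos ?ler.
rewrite -[LHS]map_id; apply/eq_in_map => k kl /=; by rewrite inordK ?ler.
Qed.

Definition beta (lam : seq nat) : nat :=
  \sum_(i < size lam) \sum_(j < size lam) gcdn (nth 0 lam i) (nth 0 lam j).

Definition ee (k : nat) : nat := ~~ odd k.
Definition ff (k : nat) : nat := k %% 4 == 2.
Definition ee2 (k l : nat) : nat := ~~ odd k || ~~ odd l.

(* In nat: for positive parts no subtraction truncates and the halving is
   exact, see zetaE. *)
Definition zeta (lam : seq nat) : nat :=
  (\sum_(i < size lam) ((1 + ee (nth 0 lam i)) * (nth 0 lam i + 1)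
                        - 2 * (ff (nth 0 lam i) + 1))) %/ 2
  + \sum_(i < size lam) \sum_(j < size lam | i < j)
      (1 + ee2 (nth 0 lam i) (nth 0 lam j)) * gcdn (nth 0 lam i) (nth 0 lam j).

Definition eta (lam : seq nat) : nat :=
  \sum_(i < size lam) (1 - ee (nth 0 lam i) + 2 * ff (nth 0 lam i)).

Definition wt (lam : seq nat) : nat :=
  \prod_(l <- undup lam) (l ^ count_mem l lam * (count_mem l lam)`!).

Local Open Scope ring_scope.

Lemma zetaE (lam : seq nat) : all (fun k => (0 < k)%N) lam ->
  (zeta lam)%:R =
    2^-1 * (\sum_(i < size lam)
        ((1 + (ee (nth 0%N lam i))%:R) * ((nth 0%N lam i)%:R + 1)
          - 2 * ((ff (nth 0%N lam i))%:R + 1)))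
    + \sum_(i < size lam) \sum_(j < size lam | (i < j)%N)
        (1 + (ee2 (nth 0%N lam i) (nth 0%N lam j))%:R)
        * (gcdn (nth 0%N lam i) (nth 0%N lam j))%:R :> rat.
Proof.
move=> /all_nthP pos; rewrite /zeta natrD; congr (_ + _); last first.
  rewrite natr_sum; apply: eq_bigr => i _; rewrite natr_sum.
  by apply: eq_bigr => j _; rewrite natrM natrD.
have key (k : nat) : (0 < k)%N ->
    (2 * (ff k + 1) <= (1 + ee k) * (k + 1))%N /\
    (2 %| (1 + ee k) * (k + 1) - 2 * (ff k + 1))%N.
  rewrite /ee /ff => k0; have [ok|ek] := boolP (odd k); case: eqP => h /=; lia.
have d2 : (2 %| \sum_(i < size lam) ((1 + ee (nth 0 lam i)) * (nth 0 lam i + 1)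
                        - 2 * (ff (nth 0 lam i) + 1)))%N.
  by apply: dvdn_sum => i _; case: (key _ (pos 0%N i (ltn_ord i))).
have := divnK d2; set q := (_ %/ 2)%N => /(congr1 (fun m => m%:R : rat)).
rewrite natrM natr_sum => hq.
have -> : q%:R = 2^-1 * (q%:R * 2) :> rat by field.
rewrite hq; congr (_ * _); apply: eq_bigr => i _.
have [h _] := key _ (pos 0%N i (ltn_ord i)).
by rewrite natrB // !natrM !natrD.
Qed.

Definition Enum (n r : nat) (lam : seq nat) : nat :=
  (stirling2 (beta lam + 1) (n - r)
   + \sum_(0 <= j < (zeta lam).+1)
       'C(zeta lam, j) *
       \sum_(0 <= t < (minn j ((n - r - 1) %/ 2)).+1)
         acoef j t * stirling2 (zeta lam + eta lam - j + 1) (n - r - 2 * t))%N.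

Definition E (n : nat) : rat :=
  \sum_(1 <= r < n.-1) \sum_(lam <- partitions r)
    (Enum n r lam)%:R / (2 * (wt lam)%:R).

(* Main.v *)
Require Import Defs.
From mathcomp Require Import all_boot all_order all_algebra all_fingroup.
From mathcomp Require Import zify ring.

Set Implicit Arguments.
Unset Strict Implicit.
Unset Printing Implicit Defensive.

Import Order.TTheory GRing.Theory Num.Theory.

(** A 3-nilpotent semigroup S with A = S \ S^2 amounts to a map from A x A
    together with an extra point (the zero) onto S^2. By Burnside's lemma for the
    group generated by relabellings and duality, the number of equivalence
    classes is the number of pairs (S, f), f an automorphism or an
    anti-automorphism of S, divided by 2 n!. Keep only the pairs for which f
    (resp. f^2, when f reverses products) fixes S^2 pointwise: nothing is lost
    when S is semirigid, since f^2 is an automorphism, and the number of remaining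
    pairs is exactly 2 n! E_n.

    To count them, fix A and write f as a permutation g of A times an involution
    of S^2. The semigroups fixed by f are equivariant surjections, whose number is
    found by Moebius inversion over the stable subsets of S^2, and depends only on
    the numbers of orbits of even and odd length of (x, y) |-> (g y, g x); these
    are zeta and eta of the cycle type of g. Finally the sum over g is turned into
    a sum over partitions by conditioning on the cycle of a fixed point. *)

(** * Maps sorted by kernel, and Stirling numbers *)

Section Kernels.

Variables aT rT : finType.

(** A map with kernel [P] is the projection onto the blocks followed by an injection on the blocks.
    [F] composes with the projection; a chosen point [rp B] of each block recovers the injection. *)
Lemma card_kernel (P : {set {set aT}}) : partition P [set: aT] ->
  #|[set f : {ffun aT -> rT} | preim_partition f [set: aT] == P]| = #|rT| ^_ #|P|.
Proof.
move=> partP; have [/eqP covP trivP P0] := and3P partP.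
pose pT := {B : {set aT} | B \in P}.
have inC x : x \in cover P by rewrite covP inE.
pose blk x : pT := exist _ (pblock P x) (pblock_mem (inC x)).
have blk_eq x y : (blk x == blk y) = (y \in pblock P x).
  by rewrite -eq_pblock // -val_eqE.
pose F (g : {ffun pT -> rT}) : {ffun aT -> rT} := [ffun x => g (blk x)].
have ex (B : pT) : exists x, x \in val B.
  by apply/set0Pn; apply: contraNneq P0 => <-; exact: (valP B).
pose rp (B : pT) := xchoose (ex B).
have blk_mem (B : pT) x : x \in val B -> blk x = B.
  by move=> xB; apply: val_inj; rewrite /= (def_pblock trivP (valP B) xB).
have rpK B : blk (rp B) = B by apply: blk_mem; exact: xchooseP.
have F_inj : injective F.
  move=> g1 g2 /ffunP eqF; apply/ffunP => B.
  by have := eqF (rp B); rewrite !ffunE rpK.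
rewrite -[#|P|](card_sig (mem P)) -card_inj_ffuns -(card_imset _ F_inj).
apply: eq_card => f; rewrite inE; apply/eqP/imsetP => [kf|[g]].
- have kerE x y : (f x == f y) = (y \in pblock P x).
    by rewrite -kf pblock_equivalence_partition ?inE //;
      split=> // /eqP ->.
  exists [ffun B => f (rp B)].
    rewrite inE; apply/injectiveP => B C; rewrite !ffunE => /eqP.
    by rewrite kerE -blk_eq !rpK => /eqP.
  apply/ffunP => x; rewrite !ffunE; apply/eqP.
  by rewrite kerE -blk_eq rpK.
- rewrite inE => /injectiveP g_inj ->.
  rewrite -[RHS](equivalence_partition_pblock partP).
  rewrite /preim_partition /equivalence_partition.
  apply: eq_imset => x; apply/setP => y; rewrite !inE !ffunE.
  by rewrite (inj_eq g_inj) blk_eq.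
Qed.

End Kernels.

(** Sort all maps by kernel: each kernel with i blocks accounts for C(k, i) i! maps. *)
Lemma expn_stirling2 k a :
  k ^ a = \sum_(i < k.+1) 'C(k, i) * (i`! * stirling2 a i).
Proof.
rewrite -{1}(card_ord k) -{1}(card_ord a) -card_ffun -sum1_card.
rewrite (partition_big (fun f : {ffun 'I_a -> 'I_k} => preim_partition f setT)
          (fun P => partition P [set: 'I_a])) /=; last first.
  by move=> f _; exact: preim_partitionP.
have step P : partition P [set: 'I_a] ->
  \sum_(f : {ffun 'I_a -> 'I_k} | preim_partition f setT == P) 1
   = \sum_(i < k.+1 | #|P| == i) 'C(k, i) * i`!.
  move=> pP; rewrite sum1dep_card card_kernel // card_ord.
  have [lt|] := ltnP k #|P|.
    rewrite ffact_small // big1 // => i /eqP e.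
    by move: lt; rewrite e ltnNge -ltnS ltn_ord.
  rewrite -ltnS => ge; by rewrite (big_pred1 (Ordinal ge)) //= ?bin_ffact // => i; rewrite -val_eqE eq_sym.
rewrite (eq_bigr _ step) (exchange_big_dep predT) //=; apply: eq_bigr => i _.
rewrite sum_nat_cond_const mulnC -mulnA; do 2!congr (_ * _).
Qed.

Lemma stirling2_0r a : stirling2 a 0 = (a == 0).
Proof.
have := expn_stirling2 0 a; rewrite big_ord1 bin0 !mul1n => <-.
by case: a => [|a] //; rewrite exp0n.
Qed.

Lemma stirling2_small a b : a < b -> stirling2 a b = 0.
Proof.
move=> ab; apply/eqP; rewrite cards_eq0; apply/eqP/setP => P; rewrite !inE.
apply/negP => /andP[pP /eqP cP]; move: ab; rewrite -cP ltnNge => /negP; apply.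
rewrite -[X in _ <= X]card_ord -cardsT (card_partition pP) -sum1_card.
apply: leq_sum => B BP; rewrite card_gt0; apply: contraTneq BP => ->.
by case/and3P: pP.
Qed.

Lemma sum_powerset_card (V : nmodType) (T : finType) (B : {set T}) (F : nat -> V) :
  (\sum_(U : {set T} | U \subset B) F #|U| = \sum_(i < #|B|.+1) F i *+ 'C(#|B|, i))%R.
Proof.
rewrite (partition_big (fun U : {set T} => inord #|U| : 'I_#|B|.+1) predT) //=.
apply: eq_bigr => i _.
rewrite (eq_bigl (fun U => U \in [set U : {set T} | U \subset B & #|U| == i])).
  rewrite (eq_bigr (fun=> F i)); last by move=> U; rewrite inE => /andP[_ /eqP->].
  by rewrite sumr_const cards_draws.
move=> U; rewrite inE; case sU: (U \subset B) => //=.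
by rewrite -val_eqE /= inordK // ltnS subset_leq_card.
Qed.

(* The value at (z, e, b, t) counts the equivariant surjections from a set with
   z even and e odd orbits onto a set on which an involution has b fixed points
   and t orbits of length 2; j is the number of even orbits sent to the latter. *)
Definition mixed_surj z e b t : nat :=
  \sum_(j < z.+1) 'C(z, j) *
    (2 ^ j * (t`! * stirling2 j t) * (b`! * stirling2 (z - j + e) b)).

(** The right side counts all equivariant maps: an even orbit may start at any of the b + 2t points,
    an odd orbit only at a fixed point. The left side sorts them by image. The proof expands the
    power of b + 2t and applies [expn_stirling2] to the powers of t and b. *)
Lemma mixed_surj_sum z e b t :
  \sum_(c < b.+1) \sum_(d < t.+1) 'C(b, c) * ('C(t, d) * mixed_surj z e c d)
  = (b + 2 * t) ^ z * b ^ e.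
Proof.
transitivity (\sum_(j < z.+1) 'C(z, j) *
    (2 ^ j * t ^ j * b ^ (z - j + e))); last first.
  rewrite expnDn big_distrl; apply: eq_bigr => j _ /=.
  by rewrite expnD expnMn; lia.
under eq_bigr => c _ do under eq_bigr => d _ do rewrite /mixed_surj !big_distrr /=.
under eq_bigr => c _ do rewrite exchange_big /=.
rewrite exchange_big /=; apply: eq_bigr => j _.
have -> X Y : 'C(z, j) * (2 ^ j * X * Y) = 'C(z, j) * 2 ^ j * (Y * X) by lia.
rewrite (expn_stirling2 t) (expn_stirling2 b) big_distrlr big_distrr /=.
apply: eq_bigr => c _; rewrite big_distrr /=.
by apply: eq_bigr => d _; lia.
Qed.

(** Without orbits of length 2 in the target only j = 0 survives, and the parity of the source
    orbits no longer matters. *)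
Lemma mixed_surj0 z e b : mixed_surj z e b 0 = b`! * stirling2 (z + e) b.
Proof.
rewrite /mixed_surj big_ord_recl big1 => [|j _]; last first.
  by rewrite stirling2_0r /= !muln0.
by rewrite /= stirling2_0r bin0 subn0 fact0; lia.
Qed.

(** * Stable subsets under an involution *)

Section StableSubsets.

Variables (T : finType) (f : {perm T}).
Implicit Types Y U V : {set T}.

Definition stableb Y := [forall (y | y \in Y), f y \in Y].
Definition fixpts Y := [set y in Y | f y == y].
(** When [f] is an involution on a stable [Y], this picks one point from each orbit of length 2. *)
Definition lowpts Y := [set y in Y | enum_rank y < enum_rank (f y)].

Lemma stableP Y : reflect {in Y, forall y, f y \in Y} (stableb Y).
Proof. by apply: (iffP forall_inP). Qed.

Variable Y0 : {set T}.
Hypothesis fK : {in Y0, forall y, f (f y) = y}.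

Let rank_lt y : y \in Y0 -> f y != y ->
  (enum_rank y < enum_rank (f y)) = ~~ (enum_rank (f y) < enum_rank (f (f y))).
Proof.
move=> yY ny; rewrite fK // -leqNgt ltn_neqAle.
by rewrite val_eqE (inj_eq enum_rank_inj) eq_sym (negbTE ny).
Qed.

(** A stable subset of [Y0] amounts to a free choice of some fixed points and some low points of
    [Y0]; [glue] rebuilds the subset from them. *)
Let glue (p : {set T} * {set T}) := p.1 :|: (p.2 :|: f @: p.2).

Let glueK Y : Y \subset Y0 -> stableb Y -> glue (fixpts Y, lowpts Y) = Y.
Proof.
move=> /subsetP sY /stableP st; apply/setP => y; rewrite !inE.
apply/or3P/idP => [[/andP[]|/andP[]|/imsetP[x]]|yY] //.
  by rewrite inE => /andP[/st xY _] ->.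
have [->|ny] := eqVneq (f y) y; first by apply: Or31; rewrite yY.
have [lt|ge] := boolP (enum_rank y < enum_rank (f y)).
  by apply: Or32; rewrite yY.
apply: Or33; apply/imsetP; exists (f y); last by rewrite fK ?sY.
by rewrite inE st //; move: ge; rewrite rank_lt ?sY // negbK.
Qed.

Hypothesis stY : stableb Y0.

Let glueP U V : U \subset fixpts Y0 -> V \subset lowpts Y0 ->
  [/\ glue (U, V) \subset Y0, stableb (glue (U, V)),
      fixpts (glue (U, V)) = U & lowpts (glue (U, V)) = V].
Proof.
move=> /subsetP sU /subsetP sV.
have inU y : y \in U -> y \in Y0 /\ f y = y.
  by move/sU; rewrite inE => /andP[? /eqP].
have inV y : y \in V -> [/\ y \in Y0, f y \in Y0 & enum_rank y < enum_rank (f y)].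
  by move/sV; rewrite inE => /andP[yY ->]; split=> //; exact: (stableP _ stY).
split.
- apply/subsetP => y; rewrite !inE => /or3P[/inU[]|/inV[]|/imsetP[x /inV[_ fx _] ->]] //.
- apply/stableP => y; rewrite !inE.
  case/or3P=> [yU|yV|/imsetP[x xV ->]]; first by have [_ ->] := inU _ yU; rewrite yU.
    by rewrite imset_f ?orbT.
  by have [xY _ _] := inV _ xV; rewrite fK // xV orbT.
- apply/setP => y; rewrite !inE; apply/andP/idP => [[]|yU]; last first.
    by have [_ ->] := inU _ yU; rewrite yU eqxx.
  case/or3P=> [//|yV|/imsetP[x xV ->]] /eqP e.
    by have [_ _] := inV _ yV; rewrite e ltnn.
  by have [_ _] := inV _ xV; rewrite (perm_inj e) ltnn.
- apply/setP => y; rewrite !inE; apply/andP/idP => [[]|yV]; last first.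
    by have [_ _ ->] := inV _ yV; rewrite yV orbT.
  case/or3P=> [yU|//|/imsetP[x xV ->]]; first by have [_ ->] := inU _ yU; rewrite ltnn.
  have [xY _ lt] := inV _ xV; rewrite fK // ltnNge (ltnW lt) //.
Qed.

Lemma sum_stable (F : nat -> nat -> nat) :
  \sum_(Y : {set T} | (Y \subset Y0) && stableb Y) F #|fixpts Y| #|lowpts Y| =
  \sum_(c < #|fixpts Y0|.+1) \sum_(d < #|lowpts Y0|.+1)
     'C(#|fixpts Y0|, c) * ('C(#|lowpts Y0|, d) * F c d).
Proof.
rewrite (reindex_onto glue (fun Y => (fixpts Y, lowpts Y))); last first.
  by move=> Y /andP[sY st]; exact: glueK.
transitivity (\sum_(p : {set T} * {set T} | (p.1 \subset fixpts Y0) && (p.2 \subset lowpts Y0))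
               F #|p.1| #|p.2|).
  apply: eq_big => [[U V]|[U V] /andP[_ /eqP[-> ->]]] //=.
  apply/idP/idP=> [/andP[/andP[/subsetP sY st] /eqP[eU eV]]|/andP[sU sV]].
    apply/andP; split; apply/subsetP => y.
      by rewrite -eU inE => /andP[/sY yY e]; rewrite inE yY e.
    by rewrite -eV inE => /andP[/sY yY e]; rewrite inE yY e.
  by have [-> -> -> ->] := glueP sU sV; rewrite eqxx.
rewrite -(pair_big (fun U => U \subset _) (fun V => V \subset _)
           (fun U V => F #|U| #|V|)) /=.
rewrite (sum_powerset_card _ (fun c => \sum_(V : {set T} | V \subset lowpts Y0) F c #|V|)).
apply: eq_bigr => c _; rewrite sum_powerset_card -mulr_natr mulrC.
rewrite natn mulr_sumr; apply: eq_bigr => d _.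
by rewrite -[(F c d *+ _)%R]mulr_natr natn [X in (_ * X)%R]mulrC.
Qed.

(** [f] carries the low points onto the points that are neither fixed nor low. *)
Lemma card_fix_low : #|Y0| = #|fixpts Y0| + 2 * #|lowpts Y0|.
Proof.
rewrite -(cardsID (fixpts Y0)) -(cardsID (lowpts Y0) (_ :\: _)).
have -> : Y0 :&: fixpts Y0 = fixpts Y0.
  by apply/setP => y; rewrite !inE; case: (y \in Y0).
have -> : (Y0 :\: fixpts Y0) :&: lowpts Y0 = lowpts Y0.
  apply/setP => y; rewrite !inE; case: (y \in Y0); rewrite ?andbF //= andbT.
  by case: eqP => // ->; rewrite ltnn.
suff -> : (Y0 :\: fixpts Y0) :\: lowpts Y0 = f @: lowpts Y0.
  by rewrite card_imset ?mul2n ?addnn //; exact: perm_inj.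
apply/setP => y; apply/idP/imsetP => [|[x]]; rewrite !inE.
  case yY: (y \in Y0); rewrite ?andbF //= andbT => /andP[ge ny].
  exists (f y); last by rewrite fK.
  by rewrite inE (stableP _ stY) //; move: ge; rewrite (@rank_lt y) // negbK.
move=> /andP[xY lt] ->; rewrite (stableP _ stY) //= andbT fK //.
rewrite -leqNgt (ltnW lt) /=; by apply: contraTneq lt => e; rewrite -e ltnn.
Qed.

End StableSubsets.

(** * Orbit lengths and equivariant maps *)

Lemma iter_modn_fix (T : Type) (f : T -> T) d n y :
  iter d f y = y -> iter (n %% d) f y = iter n f y.
Proof.
move=> fy; rewrite {2}(divn_eq n d) addnC iterD; congr (iter _ _ _).
by elim: (n %/ d) => //= q IH; rewrite mulSn iterD -IH fy.
Qed.

Lemma findex_iter_modn (T : finType) (h : T -> T) r j : injective h ->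
  findex h r (iter j h r) = j %% fingraph.order h r.
Proof.
move=> h_inj; rewrite -(iter_modn_fix j (iter_order h_inj r)).
by rewrite findex_iter // ltn_mod fingraph.order_gt0.
Qed.

Lemma iter_eq_order (T : finType) (h : T -> T) x n : injective h ->
  (iter n h x == x) = (fingraph.order h x %| n).
Proof.
move=> h_inj; rewrite -(iter_modn_fix n (iter_order h_inj x)) /dvdn.
apply/eqP/eqP => [e|->] //.
by rewrite -(findex_iter (f := h) (ltn_pmod n (fingraph.order_gt0 h x))) e findex0.
Qed.

Section Equivariant.

Variables (U T : finType) (h : U -> U) (f : {perm T}) (D : {set U}) (y0 : T).
Hypothesis h_inj : injective h.
Hypothesis hD : {in D, forall u, h u \in D}.

Definition equivariant (p : {ffun U -> T}) := [forall (u | u \in D), p (h u) == f (p u)].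

(** Each orbit in [D] is represented by its root, so the cardinality of this set is a number of
    orbits. *)
Definition orbits_with (q : pred nat) :=
  [set u in D | (u \in froots h) && q (fingraph.order h u)].

Let iter_inD j u : u \in D -> iter j h u \in D.
Proof. by move=> uD; elim: j => //= j; exact: hD. Qed.

Let rootD u : u \in D -> froot h u \in D.
Proof. by move=> uD; have /iter_findex <- := connect_root (frel h) u; exact: iter_inD. Qed.

Let equivariant_iter p j u : equivariant p -> u \in D -> p (iter j h u) = iter j f (p u).
Proof.
move=> /forall_inP eqp uD; elim: j => //= j IH.
by rewrite (eqP (eqp _ (iter_inD j uD))) IH.
Qed.

Let conn_root u : fconnect h (froot h u) u.
Proof. by rewrite fconnect_sym // connect_root. Qed.

(** An equivariant map is determined by its values at the orbit roots. The value at a root whose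
    orbit has length d can be any point of [Y] fixed by the d-th iterate of [f]. *)
Lemma card_equivariant (Y : {set T}) : stableb f Y ->
  #|[set p in pffun_on y0 (mem D) (mem Y) | equivariant p]| =
  \prod_(u in orbits_with predT) #|[set y in Y | iter (fingraph.order h u) f y == y]|.
Proof.
move=> /stableP stY.
pose R := orbits_with predT.
pose F u := [set y in Y | iter (fingraph.order h u) f y == y].
have inR u : (u \in R) = (u \in D) && (froot h u == u).
  by rewrite inE andbT.
transitivity #|pfamily y0 (mem R) F|; last first.
  by rewrite card_pfamily foldrE big_image.
have iterY j y : y \in Y -> iter j f y \in Y.
  by move=> yY; elim: j => //= j; exact: stY.
(* A point reached from its root in i steps gets the i-th [f]-iterate of the root value; [y0] is the
   default outside [D]. *)
pose ext (q : {ffun U -> T}) : {ffun U -> T} :=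
  [ffun u => if u \in D then iter (findex h (froot h u) u) f (q (froot h u)) else y0].
have extR (q : {ffun U -> T}) u : u \in R -> ext q u = q u.
  by rewrite inR => /andP[uD /eqP e]; rewrite ffunE uD e findex0.
have rootR u : u \in D -> froot h u \in R.
  by move=> uD; rewrite inR rootD // (root_root (fconnect_sym h_inj)) /=.
rewrite -[RHS](card_in_imset (f := ext)); last first.
  move=> q1 q2 /pfamilyP[/supportP s1 _] /pfamilyP[/supportP s2 _] /ffunP e.
  apply/ffunP => u; case uR: (u \in R); last by rewrite s1 ?s2 ?uR.
  by have := e u; rewrite !extR.
apply: eq_card => p; apply/idP/imsetP.
- rewrite inE => /andP[/pffun_onP[/supportP sp imp] eqp].
  exists [ffun u => if u \in R then p u else y0].
    apply/pfamilyP; split=> [|u].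
      by apply/supportP => u uR; rewrite ffunE (negbTE uR).
    move=> uR; rewrite ffunE uR inE -equivariant_iter //; last first.
      by move: uR; rewrite inR => /andP[].
    rewrite iter_order // eqxx andbT; apply: imp; apply/imageP; exists u => //.
    by move: uR; rewrite inR => /andP[].
  apply/ffunP => u; rewrite ffunE; case: ifPn => uD; last exact: sp.
  rewrite ffunE rootR // -equivariant_iter ?rootD // iter_findex //.
- case=> q /pfamilyP[/supportP sq Fq] ->.
  have qP u : u \in D -> q (froot h u) \in Y /\
       iter (fingraph.order h (froot h u)) f (q (froot h u)) = q (froot h u).
    by move=> uD; have := Fq _ (rootR _ uD); rewrite inE => /andP[? /eqP].
  rewrite inE; apply/andP; split.
    apply/pffun_onP; split=> [|_ /imageP[u uD ->]].
      by apply/supportP => u uD; rewrite ffunE (negbTE uD).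
    by rewrite ffunE [_ \in D]uD iterY //; case: (qP u uD).
  apply/forall_inP => u uD; rewrite !ffunE uD hD //.
  have -> : froot h (h u) = froot h u.
    by apply/eqP; rewrite eq_sym (root_connect (fconnect_sym h_inj)) fconnect1.
  have [_ fr] := qP u uD; set r := froot h u in fr *.
  (* The index drops back to 0 when the orbit closes; [fr] makes this harmless. *)
  have -> : findex h r (h u) = (findex h r u).+1 %% fingraph.order h r.
    by rewrite -findex_iter_modn // iterS iter_findex //; exact: conn_root.
  by rewrite iter_modn_fix.
Qed.

Let z := #|orbits_with (fun n => ~~ odd n)|.
Let e := #|orbits_with odd|.

(** Even iterates of an involution are trivial and odd ones equal [f], so a root has [#|Y|] possible
    values on an even orbit and only the fixed points on an odd one. *)
Lemma card_equivariant_invol (Y : {set T}) :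
  stableb f Y -> {in Y, forall y, f (f y) = y} ->
  #|[set p in pffun_on y0 (mem D) (mem Y) | equivariant p]| =
  #|Y| ^ z * #|fixpts f Y| ^ e.
Proof.
move=> stY fK; rewrite card_equivariant //.
have even_iter j y : y \in Y -> iter j f y = iter (odd j) f y.
  move=> yY; rewrite -{1}(odd_double_half j) addnC iterD.
  have yY' : iter (odd j) f y \in Y by case: (odd j) => //=; exact: (stableP _ _ stY).
  elim: (j./2) => // m IH; rewrite doubleS /= IH fK //.
rewrite (bigID (fun u => ~~ odd (fingraph.order h u))) /=; congr (_ * _).
  rewrite -prod_nat_const; apply: eq_big => [u|u /andP[_ ev]].
    by rewrite !inE andbT andbA.
  by apply: eq_card => y; rewrite inE; case yY: (y \in Y); rewrite // even_iter // (negbTE ev) /= eqxx.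
rewrite -prod_nat_const; apply: eq_big => [u|u /andP[_ ev]].
  by rewrite !inE andbT andbA negbK.
apply: eq_card => y; rewrite !inE; case yY: (y \in Y); rewrite // even_iter //.
by move: ev; rewrite negbK => ->.
Qed.

(** Moebius inversion as a strong induction on [#|Y|]: the true counts and the values of
    [mixed_surj] have the same sum over the stable subsets of [Y], and agree on the proper ones. *)
Lemma card_equivariant_onto (Y : {set T}) :
  stableb f Y -> {in Y, forall y, f (f y) = y} ->
  #|[set p in pffun_on y0 (mem D) (mem Y) | equivariant p & p @: D == Y]| =
  mixed_surj z e #|fixpts f Y| #|lowpts f Y|.
Proof.
have [m] := ubnP #|Y|; elim: m Y => // m IH Y ltY stY fK.
pose K (Y : {set T}) :=
  #|[set p in pffun_on y0 (mem D) (mem Y) | equivariant p & p @: D == Y]|.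
(* Sort the equivariant maps into [Y] by their image, which is stable. *)
have eqK : \sum_(X : {set T} | (X \subset Y) && stableb f X) K X =
           #|Y| ^ z * #|fixpts f Y| ^ e.
  rewrite -card_equivariant_invol // -sum1_card.
  rewrite (partition_big (fun p : {ffun U -> T} => p @: D)
             (fun X => (X \subset Y) && stableb f X)) /=; last first.
    move=> p; rewrite inE => /andP[/pffun_onP[_ imp] /forall_inP eqp].
    apply/andP; split.
      by apply/subsetP => _ /imsetP[u uD ->]; apply: imp; apply/imageP; exists u.
    apply/stableP => _ /imsetP[u uD ->]; rewrite -(eqP (eqp u uD)).
    by rewrite imset_f // hD.
  apply: eq_bigr => X /andP[sX _]; rewrite sum1dep_card; apply: eq_card => p.
  rewrite !inE andbA; case: (@eqP _ (p @: D)) => [eX|]; last by rewrite !andbF.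
  rewrite !andbT; congr (_ && _); apply/pffun_onP/pffun_onP => -[sp imp]; split=> //.
    by move=> y /imp; apply: (subsetP sX).
  by move=> _ /imageP[u uD ->]; rewrite -eX; exact: imset_f.
have eqM := sum_stable fK stY (mixed_surj z e).
rewrite mixed_surj_sum -card_fix_low // -eqK in eqM; move: eqM.
rewrite (bigD1 Y) ?subxx //= [RHS](bigD1 Y) ?subxx //=.
rewrite [X in _ + X](eq_bigr K) => [/eqP|X /andP[/andP[sX stX] neX]].
  by rewrite eqn_add2r => /eqP->.
apply/esym/IH => //; last by move=> y /(subsetP sX); exact: fK.
by apply: leq_trans (proper_card _) ltY; rewrite properEneq neX.
Qed.

End Equivariant.

(** * Permutations preserving a subset, and cycle types *)

Section PermSplit.

Variable T : finType.
Implicit Types (f g s : {perm T}) (B C : {set T}).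

Lemma stableb_astabs f C : stableb f C -> f \in ('N(C | 'P))%g.
Proof.
move=> /stableP st; rewrite /astabs !inE /=; apply/subsetP => x xC; rewrite inE.
exact: st.
Qed.

Lemma permM_on C C' g s x : perm_on C g -> perm_on C' s -> [disjoint C & C'] ->
  (g * s)%g x = if x \in C then g x else s x.
Proof.
move=> gC sC' dis; rewrite permM; case: ifPn => xC; last by rewrite (out_perm gC).
rewrite (out_perm sC') //; apply/negP => gx.
by move/pred0P/(_ (g x)): dis; rewrite /= gx perm_closed // xC.
Qed.

(** Restricting [f] to [C] and to [B :\: C] inverts the product of permutations supported on these
    two disjoint sets. *)
Lemma sum_perm_split (V : nmodType) B C (F : {perm T} -> V) : C \subset B ->
  (\sum_(f : {perm T} | perm_on B f && stableb f C) F f =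
   \sum_(g : {perm T} | perm_on C g) \sum_(s : {perm T} | perm_on (B :\: C) s)
     F (g * s)%g)%R.
Proof.
move=> /subsetP sCB.
have dis : [disjoint C & B :\: C].
  by apply/pred0P => x /=; rewrite inE; case: (x \in C).
rewrite pair_big /=.
rewrite (reindex_onto (fun p : {perm T} * {perm T} => (p.1 * p.2)%g)
   (fun f => (restr_perm C f, restr_perm (B :\: C) f))) /=; last first.
  move=> f /andP[fB st]; apply/permP => x.
  have fC := stableb_astabs st.
  have stI y : (f y \in C) = (y \in C) by apply: (astabsP fC).
  have fBC : f \in ('N(B :\: C | 'P))%g.
    by apply/astabsP => y /=; rewrite !inE /aperm stI perm_closed.
  rewrite (permM_on _ (restr_perm_on _ _) (restr_perm_on _ _)) //.
  case: ifPn => xC; first by rewrite restr_permE.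
  have [xB|xB] := boolP (x \in B); first by rewrite restr_permE // inE xC.
  by rewrite (out_perm (restr_perm_on _ _)) ?inE ?(negbTE xB) ?andbF ?(out_perm fB).
apply: eq_bigl => [[g s]] /=; apply/idP/andP.
  by case/andP=> _ /eqP[<- <-]; rewrite !restr_perm_on.
case=> gC sC; have gsE x := permM_on x gC sC dis.
have sx x : x \notin C -> s x \notin C.
  move=> xC; have [xB|xB] := boolP (x \in B :\: C).
    by have := perm_closed x sC; rewrite xB inE => /andP[].
  by rewrite (out_perm sC).
have stC : stableb (g * s)%g C.
  by apply/stableP => x xC; rewrite gsE xC perm_closed.
have stI y : ((g * s)%g y \in C) = (y \in C).
  by apply: (astabsP (stableb_astabs stC)).
have onB : perm_on B (g * s)%g.
  apply/subsetP => x; rewrite inE; apply: contraR => xB; rewrite gsE.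
  rewrite ifN; last by apply: contra xB => /sCB.
  by rewrite (out_perm sC) // inE (negbTE xB) andbF.
have fBC : (g * s)%g \in ('N(B :\: C | 'P))%g.
  by apply/astabsP => y /=; rewrite !inE /aperm stI perm_closed.
rewrite onB stC /=; apply/eqP; congr (_, _); apply/permP => x.
  have [xC|xC] := boolP (x \in C).
    by rewrite restr_permE ?stableb_astabs // gsE xC.
  by rewrite (out_perm (restr_perm_on _ _)) // (out_perm gC).
have [xC|xC] := boolP (x \in B :\: C).
  by rewrite restr_permE // gsE; move: xC; rewrite inE => /andP[/negbTE->].
by rewrite (out_perm (restr_perm_on _ _)) // (out_perm sC).
Qed.

Lemma fconnect_agree (f1 f2 : T -> T) C x : {in C, forall y, f1 y \in C} ->
  {in C, f1 =1 f2} -> x \in C -> fconnect f1 x =1 fconnect f2 x.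
Proof.
move=> st eqf xC; have E j : iter j f1 x = iter j f2 x /\ iter j f1 x \in C.
  elim: j => //= j [<- jC]; split; [exact: eqf | exact: st].
move=> y; apply/idP/idP => /iter_findex <-.
  by have [-> _] := E (findex f1 x y); rewrite fconnect_iter.
by have [<- _] := E (findex f2 x y); rewrite fconnect_iter.
Qed.

Definition cyc f x := [set y | fconnect f x y].
Definition cycles B f := cyc f @: B.
(** Fixed points in [B] count as cycles of length 1. The list comes in no particular order, hence
    the invariance under [perm_eq] asked of functions of it. *)
Definition cycle_type B f := [seq #|C| | C : {set T} in cycles B f].

Lemma card_cyc f x : #|cyc f x| = fingraph.order f x.
Proof. by rewrite /fingraph.order cardsE. Qed.

Lemma mem_cyc f x : x \in cyc f x.
Proof. by rewrite inE connect0. Qed.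

Lemma cyc_eq f x y : (cyc f x == cyc f y) = (y \in cyc f x).
Proof.
apply/eqP/idP => [->|]; first exact: mem_cyc.
rewrite inE => xy; apply/setP => z; rewrite !inE.
by apply: (same_connect (fconnect_sym (@perm_inj _ f))).
Qed.

Lemma cyc_sub B f x : perm_on B f -> x \in B -> cyc f x \subset B.
Proof.
move=> fB xB; apply/subsetP => y; rewrite inE => /iter_findex <-.
by elim: (findex _ _ _) => //= j; rewrite perm_closed.
Qed.

(** Group the points by cycle: a cycle of length k gives k equal terms. *)
Lemma sum_cycle_type (V : nmodType) B f (F : nat -> V) : perm_on B f ->
  (\sum_(x in B) F (fingraph.order f x) = \sum_(k <- cycle_type B f) F k *+ k)%R.
Proof.
move=> fB; rewrite big_image /=.
rewrite (partition_big (cyc f) (mem (cycles B f))) /=; last first.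
  by move=> x xB; exact: imset_f.
apply: eq_bigr => _ /imsetP[x xB ->].
rewrite (eq_bigl (mem (cyc f x))) => [|y].
  rewrite (eq_bigr (fun=> F #|cyc f x|)) ?sumr_const // => y.
  by rewrite /= -cyc_eq -card_cyc => /eqP->.
rewrite eq_sym cyc_eq /=; case yx: (y \in cyc f x); rewrite ?andbF ?andbT //.
by rewrite (subsetP (cyc_sub fB xB)).
Qed.

End PermSplit.

(** * Conditioning on the cycle of a point *)

Section CycleRecursion.

Variable T : finType.
Implicit Types (f g s : {perm T}) (B C : {set T}).

Lemma cyc_mul C C' g s x : perm_on C g -> perm_on C' s -> [disjoint C & C'] ->
  x \in C -> cyc (g * s)%g x = cyc g x.
Proof.
move=> gC sC' dis xC; apply/setP => y; rewrite !inE; apply/esym.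
apply: (fconnect_agree _ _ xC) => z zC; first by rewrite perm_closed.
by rewrite (permM_on _ gC sC' dis) zC.
Qed.

Lemma cycle_type_cons B C g s x0 : C \subset B -> perm_on C g -> perm_on (B :\: C) s ->
  x0 \in C -> cyc g x0 = C ->
  perm_eq (cycle_type B (g * s)%g) (#|C| :: cycle_type (B :\: C) s).
Proof.
move=> sCB gC sBC x0C cx0.
have dis : [disjoint C & B :\: C].
  by apply/pred0P => x /=; rewrite inE; case: (x \in C).
have dis' : [disjoint B :\: C & C] by rewrite disjoint_sym.
have eqC x : x \in C -> cyc (g * s)%g x = C.
  by move=> xC; rewrite (cyc_mul gC sBC) // -cx0; apply/eqP; rewrite eq_sym cyc_eq cx0.
have eqBC x : x \in B :\: C -> cyc (g * s)%g x = cyc s x.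
  by move=> xC; rewrite (perm_onC gC sBC) // (cyc_mul sBC gC).
have E : cycles B (g * s)%g = C |: cycles (B :\: C) s.
  apply/setP => X; rewrite !inE; apply/imsetP/orP => [[x xB ->]|].
    have [xC|xC] := boolP (x \in C); first by left; rewrite eqC.
    by right; rewrite eqBC ?inE ?xC //; apply: imset_f; rewrite inE xC.
  case=> [/eqP->|/imsetP[x xC ->]]; first by exists x0; rewrite ?eqC ?(subsetP sCB).
  by exists x; rewrite ?eqBC //; move: xC; rewrite inE => /andP[].
have nC : C \notin cycles (B :\: C) s.
  apply/negP => /imsetP[x xC eC]; move: xC; rewrite inE => /andP[/negP[]].
  by rewrite eC mem_cyc.
rewrite /cycle_type /image_mem -map_cons; apply: perm_map.
apply: uniq_perm => [||X]; rewrite /= ?enum_uniq ?mem_enum ?nC //.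
by rewrite inE !mem_enum E !inE.
Qed.

Definition full_cycles C x0 := #|[set g : {perm T} | perm_on C g & cyc g x0 == C]|.

(** If [C] is the cycle of [x0] under [f], then [f] is a single cycle on [C] times an arbitrary
    permutation of the remaining points. *)
Lemma sum_cycle_recursion B x0 (F : seq nat -> rat) : x0 \in B ->
  (forall l1 l2, perm_eq l1 l2 -> F l1 = F l2) ->
  (\sum_(f : {perm T} | perm_on B f) F (cycle_type B f) =
   \sum_(C : {set T} | (C \subset B) && (x0 \in C)) (full_cycles C x0)%:R *
     \sum_(s : {perm T} | perm_on (B :\: C) s) F (#|C| :: cycle_type (B :\: C) s))%R.
Proof.
move=> x0B Finv.
rewrite (partition_big (fun f => cyc f x0)
   (fun C => (C \subset B) && (x0 \in C))) /=; last first.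
  by move=> f fB; rewrite cyc_sub //= mem_cyc.
apply: eq_bigr => C /andP[sCB x0C].
have dis : [disjoint C & B :\: C].
  by apply/pred0P => x /=; rewrite inE; case: (x \in C).
(* A permutation having [C] as a cycle stabilises [C]; padding with zeros to all stabilising
   permutations allows [sum_perm_split]. *)
transitivity (\sum_(f : {perm T} | perm_on B f && stableb f C)
   (if cyc f x0 == C then F (cycle_type B f) else 0))%R.
  rewrite -big_mkcondr; apply: eq_bigl => f.
  case: eqP => [eC|]; rewrite ?andbF // !andbT.
  case: (perm_on B f) => //=; apply/esym/stableP => y; rewrite -eC !inE => xy.
  by apply: connect_trans xy (fconnect1 _ _).
rewrite sum_perm_split // /full_cycles -sum1dep_card natr_sum mulr_suml.
rewrite [RHS]big_mkcondr; apply: eq_bigr => g gC; rewrite mul1r.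
case: ifP => [/eqP cg|ncg].
  apply: eq_bigr => s sC; rewrite (cyc_mul gC sC) // cg eqxx.
  exact/Finv/(cycle_type_cons _ _ _ x0C cg).
by apply: big1 => s sC; rewrite (cyc_mul gC sC) // ncg.
Qed.

(** Removing [x0] leaves an arbitrary subset of [B :\ x0], which explains both shifts by one. *)
Lemma sum_pointed_card (V : nmodType) B x0 (F : nat -> V) : x0 \in B ->
  (\sum_(C : {set T} | (C \subset B) && (x0 \in C)) F #|C| =
   \sum_(i < #|B|) F i.+1 *+ 'C(#|B|.-1, i))%R.
Proof.
move=> x0B; rewrite (reindex_onto (fun C => x0 |: C) (fun C => C :\ x0)); last first.
  by move=> C /andP[_ x0C]; rewrite setD1K.
rewrite (eq_bigl (fun C => C \subset B :\ x0)) => [|C].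
  rewrite (eq_bigr (fun C : {set T} => F #|C|.+1)) => [|C sC]; last first.
    rewrite cardsU1; case: (boolP (x0 \in C)) => // /(subsetP sC).
    by rewrite !inE eqxx.
  by rewrite (sum_powerset_card _ (fun i => F i.+1)) [#|B|](cardsD1 x0) x0B.
rewrite subUset sub1set x0B setU11 andbT /= subsetD1; congr (_ && _).
apply/eqP/idP => [<-|x0C]; first by rewrite !inE eqxx.
by rewrite setU1K.
Qed.

(** The recursion with constant function 1 writes n! as a sum over the subsets containing [x0]. The
    values (c-1)! satisfy the same identity, each of the n sizes contributing (n-1)!; by induction
    the proper subsets cancel. *)
Lemma card_full_cycles C x0 : x0 \in C -> full_cycles C x0 = #|C|.-1`!.
Proof.
have [m] := ubnP #|C|; elim: m C => // m IH C ltC x0C.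
have := sum_cycle_recursion (F := fun=> 1%R) x0C (fun _ _ _ => erefl).
rewrite sumr_const.
under eq_bigr => X _ do rewrite sumr_const -natrM.
rewrite (card_perm C) -natr_sum => /eqP; rewrite eqr_nat => /eqP.
have -> : #|C|`! = \sum_(X : {set T} | (X \subset C) && (x0 \in X)) #|X|.-1`! * (#|C| - #|X|)`!.
  rewrite (sum_pointed_card (fun i => i.-1`! * (#|C| - i)`!)) //.
  have C0 : 0 < #|C| by apply/card_gt0P; exists x0.
  rewrite (eq_bigr (fun=> #|C|.-1`!)) => [|i _].
    by rewrite sum_nat_const card_ord -{1}(prednK C0) factS prednK.
  rewrite -mulr_natl natn /=.
  have -> : #|C| - i.+1 = #|C|.-1 - i by lia.
  by apply: bin_fact; have := ltn_ord i; lia.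
rewrite (bigD1 C) ?subxx //= [RHS](bigD1 C) ?subxx //=.
rewrite [X in _ = _ + X](eq_bigr (fun X : {set T} => #|X|.-1`! * (#|C| - #|X|)`!)).
  move/eqP; rewrite eqn_add2r (card_perm (C :\: C)) setDv cards0 subnn fact0 !muln1.
  by move/eqP.
move=> X /andP[/andP[sX x0X] neX]; rewrite (card_perm (C :\: X)) cardsD.
rewrite (setIidPr sX) IH //.
by apply: leq_trans (proper_card _) ltC; rewrite properEneq neX.
Qed.

End CycleRecursion.

(** * Weights of partitions and a recursion over parts *)

Lemma wtE N lam : all (fun k => k < N) lam ->
  wt lam = \prod_(l < N) (l ^ count_mem (val l) lam * (count_mem (val l) lam)`!).
Proof.
move=> /allP ltN; rewrite /wt -(big_mkord predT (fun l => l ^ count_mem l lam * (count_mem l lam)`!)).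
(* Sizes absent from [lam] contribute the factor 1, so the index set can be made independent of
   [lam]. *)
rewrite (perm_big [seq l <- index_iota 0 N | l \in lam]) /=; last first.
  apply: uniq_perm => [||l]; rewrite ?undup_uniq ?filter_uniq ?iota_uniq //.
  rewrite mem_undup mem_filter mem_index_iota /=.
  by case ll: (l \in lam) => //=; rewrite ltN.
rewrite big_filter big_mkcond; apply: eq_bigr => l _; case: ifPn => // ll.
by rewrite (count_memPn ll).
Qed.

Lemma perm_wt l1 l2 : perm_eq l1 l2 -> wt l1 = wt l2.
Proof.
move=> pl.
have lt : all (fun k => k < (\max_(k <- l1) k).+1) l1.
  by apply/allP => k kl; rewrite ltnS; apply: leq_bigmax_seq.
rewrite (wtE lt) (wtE (N := (\max_(k <- l1) k).+1)); last by rewrite -(perm_all _ pl).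
by apply: eq_bigr => l _; rewrite (seq.permP pl).
Qed.

Lemma wt_cons k mu : wt (k :: mu) = k * (count_mem k mu).+1 * wt mu.
Proof.
pose N := (\max_(i <- k :: mu) i).+1.
have lt : all (fun i => i < N) (k :: mu).
  by apply/allP => i il; rewrite ltnS; apply: leq_bigmax_seq.
have kN : k < N by case/andP: lt.
rewrite (wtE lt) (wtE (N := N)); last by case/andP: lt.
rewrite (bigD1 (Ordinal kN)) //= [in RHS](bigD1 (Ordinal kN)) //= eqxx add1n.
rewrite (eq_bigr (fun l : 'I_N => l ^ count_mem (val l) mu * (count_mem (val l) mu)`!)).
  by rewrite expnS factS mulnACA -!mulnA.
by move=> l; rewrite -val_eqE /= eq_sym => /negbTE->.
Qed.

Lemma wt_gt0 lam : all (fun k => 0 < k) lam -> 0 < wt lam.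
Proof.
elim: lam => [_|k mu IH /= /andP[k0 /IH mu0]]; first by rewrite /wt big_nil.
by rewrite wt_cons !muln_gt0 k0 mu0.
Qed.

Lemma sumn_count r lam : all (fun k => k < r.+1) lam ->
  sumn lam = \sum_(k < r) count_mem k.+1 lam * k.+1.
Proof.
elim: lam => [_|x lam IH /= /andP[xr /IH ->]].
  by rewrite big1.
transitivity (\sum_(k < r) (x == k.+1) * k.+1 + \sum_(k < r) count_mem k.+1 lam * k.+1).
  congr (_ + _); case: x xr => [_|x]; first by rewrite big1.
  rewrite ltnS => xr; rewrite (bigD1 (Ordinal xr)) //= eqxx mul1n big1 ?addn0 //.
  by move=> i; rewrite -val_eqE eqSS eq_sym /= => /negbTE ->.
by rewrite -big_split; apply: eq_bigr => k _; rewrite /= mulnDl.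
Qed.

Section PartitionRecursion.

Local Open Scope ring_scope.

(** As [wt lam] is the order of the centraliser of a permutation of cycle type [lam], this is the
    average of an order-blind [F] over the cycle types of the permutations of r points. *)
Definition psum r (F : seq nat -> rat) : rat :=
  \sum_(lam <- partitions r) F lam / (wt lam)%:R.

Lemma partition_le r lam : is_partition r lam -> all (fun k => (k < r.+1)%N) lam.
Proof.
case/and3P=> _ _ /eqP <-; elim: lam => //= x s IH; rewrite ltnS leq_addr /=.
by apply: sub_all IH => y; rewrite !ltnS => h; apply: leq_trans h (leq_addl _ _).
Qed.

Lemma sorted_geq_inj (l1 l2 : seq nat) :
  sorted geq l1 -> sorted geq l2 -> perm_eq l1 l2 -> l1 = l2.
Proof.
apply: sorted_eq; first by move=> y x z; exact: (fun a b => leq_trans b a).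
by move=> x y; rewrite andbC => /anti_leq.
Qed.

(** Removing one part k is a bijection; its inverse inserts k and sorts again. *)
Lemma partitions_rem r k (F : seq nat -> rat) : (0 < k <= r)%N ->
  \sum_(lam <- partitions r | k \in lam) F (rem k lam) =
  \sum_(mu <- partitions (r - k)) F mu.
Proof.
move=> /andP[k0 kr].
rewrite -big_filter -(big_map (rem k) predT F); apply: perm_big.
apply: uniq_perm (partitions_uniq _) _.
  rewrite map_inj_in_uniq ?(filter_uniq _ (partitions_uniq _)) // => l1 l2.
  rewrite mem_filter mem_partitions => /andP[k1 /and3P[s1 _ _]].
  rewrite mem_filter mem_partitions => /andP[k2 /and3P[s2 _ _]] e.
  apply: sorted_geq_inj => //; rewrite (permPl (perm_to_rem k1)).
  by rewrite (permPr (perm_to_rem k2)) e.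
move=> mu; rewrite mem_partitions; apply/mapP/idP.
  case=> lam; rewrite mem_filter mem_partitions => /andP[kl /and3P[sl al /eqP sum]] ->.
  have pl := perm_to_rem kl.
  apply/and3P; split.
  - apply: subseq_sorted sl; last exact: rem_subseq.
    by move=> y x z; exact: (fun a b => leq_trans b a).
  - by move: al; rewrite (perm_all _ pl) => /andP[].
  - by rewrite -sum (perm_sumn pl) /= addKn.
case/and3P=> sm am /eqP sum.
have kl : k \in sort geq (k :: mu) by rewrite mem_sort mem_head.
have ps : perm_eq (sort geq (k :: mu)) (k :: mu) by rewrite perm_sort.
have srt l : sorted geq (sort geq l) by apply: sort_sorted => x y; exact: leq_total.
exists (sort geq (k :: mu)).
  rewrite mem_filter kl mem_partitions /=; apply/and3P; split=> //.
    by rewrite (perm_all _ ps) /= k0.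
  by rewrite (perm_sumn ps) /= sum; apply/eqP; lia.
apply: sorted_geq_inj => //.
  apply: subseq_sorted (srt (k :: mu)); last exact: rem_subseq.
  by move=> y x z; exact: (fun a b => leq_trans b a).
by rewrite -(perm_cons k) -(permPr (perm_to_rem kl)) perm_sym.
Qed.

(** Write r as the sum over the part sizes k of k times its multiplicity. By [wt_cons] that product
    is exactly the ratio of the weights of [lam] and of [lam] with one k removed. *)
Lemma psum_recursion r (F : seq nat -> rat) :
  (forall l1 l2, perm_eq l1 l2 -> F l1 = F l2) ->
  r%:R * psum r F = \sum_(k < r) psum (r - k.+1) (fun mu => F (k.+1 :: mu)).
Proof.
move=> Finv; rewrite /psum mulr_sumr.
rewrite (eq_bigr (fun k : 'I_r => \sum_(lam <- partitions r | k.+1 \in lam)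
    F (k.+1 :: rem k.+1 lam) / (wt (rem k.+1 lam))%:R)); last first.
  move=> k _.
  rewrite -(@partitions_rem r k.+1 (fun mu => F (k.+1 :: mu) / (wt mu)%:R)) //.
  by rewrite ltn_ord.
rewrite (exchange_big_dep predT) //= big_seq [RHS]big_seq.
apply: eq_bigr => lam; rewrite mem_partitions => pl.
have [_ pos /eqP sum] := and3P pl.
rewrite -[in LHS]sum (sumn_count (partition_le pl)).
rewrite natr_sum mulr_suml [RHS]big_mkcond; apply: eq_bigr => k _ /=.
case: ifPn => [kl|/count_memPn->]; last by rewrite mul0n mul0r.
have pr := perm_to_rem kl; rewrite -(Finv _ _ pr) (perm_wt pr) wt_cons.
have -> : count_mem k.+1 lam = (count_mem k.+1 (rem k.+1 lam)).+1.
  by rewrite (seq.permP pr) /= eqxx.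
have w0 : (wt (rem k.+1 lam))%:R != 0 :> rat.
  rewrite pnatr_eq0 -lt0n wt_gt0 //.
  by move: pos; rewrite (perm_all _ pr) => /andP[].
have k0 : k.+1%:R != 0 :> rat by rewrite pnatr_eq0.
have c0 : (count_mem k.+1 (rem k.+1 lam)).+1%:R != 0 :> rat by rewrite pnatr_eq0.
rewrite !natrM; move: w0 k0 c0.
move: ((wt (rem k.+1 lam))%:R) ((count_mem k.+1 (rem k.+1 lam)).+1%:R) => w c.
move: (k.+1%:R : rat) => a w0 a0 c0.
by field; rewrite w0 a0 c0.
Qed.

End PartitionRecursion.

(** * From sums over permutations to sums over partitions *)

Section CycleTypeSum.

Local Open Scope ring_scope.
Variable T : finType.

Lemma partitions0 : partitions 0 = [:: [::]].
Proof.
apply: perm_small_eq => //; apply: uniq_perm (partitions_uniq _) _ _ => // lam.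
rewrite mem_partitions inE; case: lam => //= k lam.
by apply/negP => /and3P[_ /= /andP[k0 _]]; rewrite addn_eq0 -leqn0 leqNgt k0.
Qed.

(** By induction on [#|B|], both sides obey the same recursion: [sum_cycle_recursion] on the left,
    [psum_recursion] on the right, matched by C(n-1, i) i! (n-1-i)! = (n-1)!. *)
Lemma sum_perm_cycle_type (B : {set T}) (F : seq nat -> rat) :
  (forall l1 l2, perm_eq l1 l2 -> F l1 = F l2) ->
  \sum_(f : {perm T} | perm_on B f) F (cycle_type B f) = #|B|`!%:R * psum #|B| F.
Proof.
have [m] := ubnP #|B|; elim: m B F => // m IH B F ltB Finv.
have [->|/set0Pn[x0 x0B]] := eqVneq B set0.
  rewrite cards0 fact0 mul1r /psum partitions0 big_seq1 /wt big_nil divr1.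
  rewrite (eq_bigr (fun=> F [::])) => [|f _].
    by rewrite sumr_const (card_perm set0) cards0.
  by congr F; rewrite /cycle_type /cycles imset0 /image_mem enum_set0.
rewrite (sum_cycle_recursion x0B Finv).
pose G c : rat := c.-1`!%:R * ((#|B| - c)`!%:R * psum (#|B| - c) (fun mu => F (c :: mu))).
rewrite (eq_bigr (fun C : {set T} => G #|C|)) => [|C /andP[sC x0C]]; last first.
  rewrite card_full_cycles // /G; congr (_ * _).
  have cD : #|B :\: C| = (#|B| - #|C|)%N by rewrite cardsD (setIidPr sC).
  rewrite -cD; apply: (IH _ (fun mu => F (#|C| :: mu))) => [|l1 l2 pl]; last first.
    by apply: Finv; rewrite perm_cons.
  have C0 : (0 < #|C|)%N by apply/card_gt0P; exists x0.
  by have := subset_leq_card sC; lia.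
have B0 : (0 < #|B|)%N by apply/card_gt0P; exists x0.
rewrite (sum_pointed_card G) // -[in RHS](prednK B0) factS prednK // natrM.
rewrite [_%:R * _%:R]mulrC -mulrA psum_recursion // mulr_sumr.
apply: eq_bigr => i _; rewrite -[X in X = _]mulr_natl /G /= mulrA mulrA; congr (_ * _).
have iB := ltn_ord i.
rewrite -!natrM -mulnA; congr (_%:R).
by rewrite -(bin_fact (n := #|B|.-1) (m := i)); [do 2!congr (_ * _)%N; congr _`!; lia | lia].
Qed.

End CycleTypeSum.

(** * Sums over involutions *)

Section Involutions.

Local Open Scope ring_scope.

(** For 2t at most m, the cycle type of an involution of m points with t two-cycles. *)
Let two_one m t := sort geq (nseq t 2%N ++ nseq (m - t.*2) 1%N).

Let perm_two_one m t : perm_eq (two_one m t) (nseq t 2%N ++ nseq (m - t.*2) 1%N).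
Proof. by rewrite perm_sort. Qed.

Let count_two_one m t : count_mem 2%N (two_one m t) = t.
Proof. by rewrite (seq.permP (perm_two_one m t)) count_cat !count_nseq /= mul1n addn0. Qed.

Let wt_two_one m t : wt (two_one m t) = (2 ^ t * t`! * (m - t.*2)`!)%N.
Proof.
rewrite (perm_wt (perm_two_one m t)) (wtE (N := 3)); last first.
  by rewrite all_cat !all_nseq !orbT.
rewrite !big_ord_recl big_ord0 /= !count_cat !count_nseq /= /bump /= !mul1n !mul0n.
by rewrite !addn0 ?add0n exp1n mul1n muln1 addn1 mulnC.
Qed.

Let small_partitions m :
  perm_eq [seq lam <- partitions m | all (fun k => (k <= 2)%N) lam]
          [seq two_one m t | t <- iota 0 (m./2).+1].
Proof.
apply: uniq_perm; first exact: filter_uniq (partitions_uniq _).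
  rewrite map_inj_in_uniq ?iota_uniq // => t1 t2 _ _ e.
  by rewrite -(count_two_one m t1) e count_two_one.
move=> lam; rewrite mem_filter mem_partitions; apply/andP/mapP.
  case=> le2 /and3P[srt pos /eqP sum].
  have pl : perm_eq lam (nseq (count_mem 2%N lam) 2%N ++ nseq (count_mem 1%N lam) 1%N).
    apply/allP => x; rewrite mem_cat => xs.
    have {xs} : (x == 1%N) || (x == 2%N).
      case/orP: xs => [xl|]; last by rewrite mem_cat !mem_nseq => /orP[]/andP[_ ->]; rewrite ?orbT.
      by have := allP le2 x xl; have := allP pos x xl; case: x {xl} => [|[|[|]]].
    by case/orP => /eqP ->; rewrite /= count_cat !count_nseq /= !mul1n !mul0n ?addn0 ?add0n.
  have cm : m = ((count_mem 2%N lam).*2 + count_mem 1%N lam)%N.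
    by rewrite -sum {1}(perm_sumn pl) sumn_cat !sumn_nseq; lia.
  exists (count_mem 2%N lam); first by rewrite mem_iota; lia.
  apply: sorted_geq_inj => //; first by apply: sort_sorted => x y; exact: leq_total.
  rewrite (permPr (perm_two_one _ _)).
  by have -> : (m - (count_mem 2%N lam).*2)%N = count_mem 1%N lam by lia.
case=> t; rewrite mem_iota => tm ->; split.
  by rewrite (perm_all _ (perm_two_one _ _)) all_cat !all_nseq !orbT.
apply/and3P; split.
- by apply: sort_sorted => x y; exact: leq_total.
- by rewrite (perm_all _ (perm_two_one _ _)) all_cat !all_nseq !orbT.
- by rewrite (perm_sumn (perm_two_one _ _)) sumn_cat !sumn_nseq; apply/eqP; lia.
Qed.

(** Being an involution and the number of low points can both be read off the cycle type, so the sum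
    reduces to partitions into ones and twos, of weight 2^t t! (m-2t)!. *)
Lemma sum_involutions (T : finType) (Y : {set T}) (F : nat -> rat) :
  \sum_(s : {perm T} | perm_on Y s && [forall (y | y \in Y), s (s y) == y])
     F #|lowpts s Y| =
  #|Y|`!%:R * \sum_(0 <= t < (#|Y|./2).+1)
     F t / (2 ^ t * t`! * (#|Y| - t.*2)`!)%:R.
Proof.
pose G lam : rat := if all (fun k => (k <= 2)%N) lam then F (count_mem 2%N lam) else 0.
rewrite big_mkcondr.
rewrite (eq_bigr (fun s => G (cycle_type Y s))) => [|s sY]; last first.
  have ordE y : (s (s y) == y) = (fingraph.order s y <= 2)%N.
    rewrite -[s (s y)]/(iter 2 s y) iter_eq_order; last exact: perm_inj.
    by have := fingraph.order_gt0 s y; case: (fingraph.order s y) => [|[|[|k]]] //= _; apply/negbTE/negP => /dvdn_leq; lia.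
  rewrite /G; have -> : all (fun k => (k <= 2)%N) (cycle_type Y s) =
      [forall (y | y \in Y), s (s y) == y].
    apply/allP/forall_inP => [le2 y yY|inv _ /imageP[_ /imsetP[y yY ->] ->]].
      by rewrite ordE -card_cyc le2 //; apply/imageP; exists (cyc s y) => //; exact: imset_f.
    by rewrite card_cyc -ordE inv.
  case: ifP => // /forall_inP inv; congr F.
  have sK : {in Y, forall y, s (s y) = y} by move=> y /inv/eqP.
  have stY : stableb s Y by apply/stableP => y; rewrite perm_closed.
  (* Count the points on two-cycles twice: as the non-fixed points and as twice the number of
     two-cycles. *)
  have := sum_cycle_type (fun k => (k == 2%N) : nat) sY.
  have -> : \sum_(x in Y) ((fingraph.order s x == 2%N) : nat) = (2 * #|lowpts s Y|)%N.
    have -> : (2 * #|lowpts s Y|)%N = #|Y :\: fixpts s Y|.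
      rewrite cardsD (setIidPr _) ?(card_fix_low sK stY) ?addKn //.
      by apply/subsetP => y; rewrite inE => /andP[].
    rewrite -sum1_card big_mkcond [RHS]big_mkcond; apply: eq_bigr => y _.
    rewrite !inE; case yY: (y \in Y); rewrite ?andbF //= andbT.
    have : (fingraph.order s y <= 2)%N by rewrite -ordE inv.
    have : (s y == y) = (fingraph.order s y == 1%N).
      by rewrite -[s y]/(iter 1 s y) iter_eq_order ?dvdn1 //; exact: perm_inj.
    move=> ->; have := fingraph.order_gt0 s y.
    by case: (fingraph.order s y) => [|[|[|]]].
  have -> : \sum_(k <- cycle_type Y s) ((k == 2%N) : nat) *+ k =
            (2 * count_mem 2%N (cycle_type Y s))%N.
    elim: (cycle_type Y s) => [|k l IH]; first by rewrite big_nil.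
    rewrite big_cons IH /= mulnDr; congr (_ + _)%N.
    by case: eqP => [->|] //; rewrite mul0rn.
  by lia.
rewrite sum_perm_cycle_type => [|l1 l2 pl]; last first.
  by rewrite /G (perm_all _ pl) (seq.permP pl).
congr (_ * _); rewrite /psum /G.
transitivity (\sum_(lam <- partitions #|Y| | all (fun k => (k <= 2)%N) lam)
   F (count_mem 2%N lam) / (wt lam)%:R).
  by rewrite [RHS]big_mkcond; apply: eq_bigr => lam _; case: ifP => // _; rewrite mul0r.
rewrite -big_filter (perm_big _ (small_partitions _)) big_map /index_iota subn0.
by apply: eq_bigr => t _; rewrite count_two_one wt_two_one.
Qed.

End Involutions.

(** Each orbit of length d contributes d terms 1/d, so orbits are counted by summing over points. *)
Lemma card_orbits_with (U : finType) (h : U -> U) (D : {set U}) (q : pred nat) :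
  injective h -> {in D, forall u, h u \in D} ->
  (#|orbits_with h D q|%:R =
    \sum_(u in D) if q (fingraph.order h u) then (fingraph.order h u)%:R^-1 else 0 :> rat)%R.
Proof.
move=> h_inj hD; have symh := fconnect_sym h_inj.
have iterD j u : u \in D -> iter j h u \in D by move=> uD; elim: j => //= j; exact: hD.
have rootD u : u \in D -> froot h u \in D.
  by move=> uD; have /iter_findex <- := connect_root (frel h) u; exact: iterD.
rewrite (partition_big (froot h) (mem (orbits_with h D predT))) /=; last first.
  by move=> u uD; rewrite inE rootD //= andbT; apply: (roots_root symh).
rewrite -sum1_card natr_sum.
rewrite (eq_bigl (fun u => (u \in orbits_with h D predT) && q (fingraph.order h u))); last first.
  by move=> u; rewrite !inE andbT andbA.
rewrite big_mkcondr; apply: eq_bigr => r; rewrite inE andbT => /andP[rD /eqP rr].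
rewrite (eq_bigl (fconnect h r)) => [|u]; last first.
  rewrite -{1}rr eq_sym (root_connect symh).
  case ru: (fconnect h r u); rewrite ?andbF // andbT.
  by move/iter_findex: ru => <-; exact: iterD.
have ordE u : fconnect h r u -> fingraph.order h u = fingraph.order h r.
  by move=> ru; apply: eq_card => v; rewrite !inE; apply/esym/(same_connect symh).
rewrite (eq_bigr (fun=> if q (fingraph.order h r) then (fingraph.order h r)%:R^-1 else 0 : rat)%R);
  last by move=> u /ordE->.
rewrite sumr_const -/(fingraph.order h r); case: ifP => _; last by rewrite mul0rn.
by rewrite -[RHS]mulr_natr mulVf // pnatr_eq0 -lt0n fingraph.order_gt0.
Qed.

Lemma order_eqP (U : finType) (h : U -> U) u d : injective h ->
  (forall n, (iter n h u == u) = (d %| n)) -> fingraph.order h u = d.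
Proof.
move=> h_inj hd; apply/eqP; rewrite eqn_dvd.
by rewrite -iter_eq_order // hd dvdnn -hd iter_eq_order //= dvdnn.
Qed.

(** * Orbit lengths on pairs, straight and twisted *)

Section PairAction.

Variable T : finType.
Implicit Types (g : {perm T}) (A : {set T}) (b : bool).

(* The extra point None stands for the zero of the semigroup. *)
Definition pair_act b g (u : option (T * T)) : option (T * T) :=
  if u is Some (x, y) then Some (if b then (g y, g x) else (g x, g y)) else None.

Definition pair_dom A : {set option (T * T)} :=
  [set u | if u is Some (x, y) then (x \in A) && (y \in A) else true].

Lemma pair_act_inj b g : injective (pair_act b g).
Proof.
by case=> [[x y]|] [[x' y']|] //=; case: b => -[/perm_inj -> /perm_inj ->].
Qed.

Lemma pair_act_dom b g A : {in A, forall x, g x \in A} ->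
  {in pair_dom A, forall u, pair_act b g u \in pair_dom A}.
Proof.
by move=> gA [[x y]|]; rewrite !inE //= => /andP[/gA xA /gA yA]; case: b; apply/andP.
Qed.

Lemma iter_pair_act0 g n x y :
  iter n (pair_act false g) (Some (x, y)) = Some (iter n g x, iter n g y).
Proof. by elim: n => //= n ->. Qed.

Lemma iter_pair_act1 g n x y :
  iter n (pair_act true g) (Some (x, y)) =
  Some (if odd n then (iter n g y, iter n g x) else (iter n g x, iter n g y)).
Proof. by elim: n => //= n ->; case: (odd n). Qed.

Lemma sum_pair_dom A (F : option (T * T) -> rat) :
  (\sum_(u in pair_dom A) F u = F None + \sum_(x in A) \sum_(y in A) F (Some (x, y)))%R.
Proof.
rewrite (bigD1 None) /= ?inE //; congr (_ + _)%R.
rewrite pair_big (reindex_omap Some id) /=; last by case=> [p|] //; rewrite andbF.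
by apply: eq_big => [[x y]|[x y] _] //=; rewrite inE eqxx !andbT.
Qed.

Lemma order_pair_act0 g x y :
  fingraph.order (pair_act false g) (Some (x, y)) =
  lcmn (fingraph.order g x) (fingraph.order g y).
Proof.
apply: order_eqP => [|n]; first exact: pair_act_inj.
have g_inj := @perm_inj _ g.
by rewrite iter_pair_act0 dvdn_lcm -!(iter_eq_order _ _ g_inj).
Qed.

Lemma order_pair_act_none b g : fingraph.order (pair_act b g) None = 1.
Proof.
apply: order_eqP => [|n]; first exact: pair_act_inj.
by rewrite dvd1n; elim: n => //= n /eqP ->.
Qed.

(* The pairs lying on orbits of odd length of the twisted action. *)
Definition odd_pair g x y :=
  let k := fingraph.order g x in
  (odd k && (y == x)) || ((k %% 4 == 2) && (y == iter k./2 g x)).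

(** For even k this matters only when k is 2 mod 4, where k/2 is odd. *)
Definition odd_len k := if odd k then k else k./2.

Lemma order_iter g j x : fingraph.order g (iter j g x) = fingraph.order g x.
Proof.
apply: eq_card => v; rewrite !inE; apply/esym/same_connect.
  exact: fconnect_sym (@perm_inj _ g).
exact: fconnect_iter.
Qed.

Lemma iter_perm_inj g n : injective (iter n g).
Proof. by elim: n => [|n IH] x y //= /perm_inj/IH. Qed.

(** An even iterate acts on each coordinate. An odd iterate n fixes (x, y) only if y is the n-th
    image of x and x that of y, so k divides 2n: either k is odd and y = x, or k is 2 mod 4 and y is
    half a turn from x. *)
Lemma order_pair_act1 g x y :
  fingraph.order (pair_act true g) (Some (x, y)) =
  if odd_pair g x y then odd_len (fingraph.order g x)
  else lcmn 2 (lcmn (fingraph.order g x) (fingraph.order g y)).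
Proof.
have g_inj := @perm_inj _ g.
apply: order_eqP => [|n]; first exact: pair_act_inj.
rewrite iter_pair_act1 (inj_eq (@Some_inj _)) fun_if /=.
have k0 := fingraph.order_gt0 g x.
have [|] := boolP (odd_pair g x y); rewrite /odd_pair; set k := fingraph.order g x in k0 *.
- case/orP=> [/andP[ok /eqP ->]|/andP[/eqP k2 /eqP ->]].
    rewrite /odd_len ok; case: (odd n); rewrite xpair_eqE iter_eq_order // andbb //.
  have ok : odd k = false by lia.
  have kE : k = (k./2).*2 by lia.
  rewrite /odd_len ok; case on: (odd n); last first.
    rewrite xpair_eqE !iter_eq_order // order_iter andbb -/k {1}kE -muln2 Gauss_dvd ?coprimen2; last by lia.
    by rewrite dvdn2 on andbT.
  rewrite xpair_eqE -iterD iter_eq_order // -/k.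
  (* Apply another half turn to both sides: it returns the right one to x. *)
  have -> : (iter n g x == iter k./2 g x) = (k %| k./2 + n).
    rewrite -(inj_eq (@iter_perm_inj g k./2)) -!iterD addnn -kE iter_order //.
    by rewrite iter_eq_order.
  rewrite addnC andbb {1}kE -muln2 Gauss_dvd ?coprimen2; last by lia.
  rewrite dvdn_addr // dvdn2 oddD on; case: (k./2 %| n) => //=; lia.
- move=> nsp; rewrite !dvdn_lcm dvdn2 -!iter_eq_order // -/k.
  case on: (odd n); rewrite xpair_eqE //=; apply/negbTE/negP => /andP[/eqP yx /eqP xy].
  move/negP: nsp; apply.
  have kn : k %| n + n by rewrite -iter_eq_order // iterD xy yx.
  case ok: (odd k) => /=.
    rewrite -xy iter_eq_order // -/k; apply/orP; left.
    by move: kn; rewrite addnn -mul2n Gauss_dvdr // coprimen2.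
  have kE : k = (k./2).*2 by lia.
  have : k./2 %| n by move: kn; rewrite addnn {1}kE -!mul2n dvdn_pmul2l.
  case/dvdnP=> q nE.
  (* n is odd, so both factors are; hence k is 2 mod 4. *)
  have oq : odd q && odd k./2 by rewrite -oddM -nE.
  have -> : k %% 4 == 2 by lia.
  rewrite -xy nE; apply/eqP.
  have qE : q = (q./2).*2.+1 by lia.
  (* An odd number of half turns is one half turn plus full turns. *)
  rewrite {1}qE mulSn -doubleMl doubleMr -kE iterD; congr (iter _ _ _).
  by apply/eqP; rewrite iter_eq_order // dvdn_mull.
Qed.

End PairAction.

(** * The exponents [beta], [zeta] and [eta] as sums over parts *)

Lemma big_nth_ord (V : nmodType) (lam : seq nat) (F : nat -> V) :
  (\sum_(i < size lam) F (nth 0%N lam i) = \sum_(k <- lam) F k)%R.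
Proof. by rewrite (big_nth 0%N) big_mkord. Qed.

Lemma beta_seq lam : beta lam = \sum_(k <- lam) \sum_(l <- lam) gcdn k l.
Proof.
rewrite -(big_nth_ord lam (fun k => \sum_(l <- lam) gcdn k l)).
by apply: eq_bigr => i _; rewrite -(big_nth_ord lam (gcdn _)).
Qed.

Lemma eta_seq lam : eta lam = \sum_(k <- lam) (1 - ee k + 2 * ff k).
Proof. exact: (big_nth_ord lam (fun k => 1 - ee k + 2 * ff k)). Qed.

Lemma sum_sym_lt n (c : nat -> nat -> nat) : (forall i j, c i j = c j i) ->
  \sum_(i < n) \sum_(j < n) c i j =
  \sum_(i < n) c i i + 2 * \sum_(i < n) \sum_(j < n | i < j) c i j.
Proof.
move=> csym.
have flip : \sum_(i < n) \sum_(j < n | j < i) c i j = \sum_(i < n) \sum_(j < n | i < j) c i j.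
  rewrite (exchange_big_dep predT) //=; apply: eq_bigr => j _.
  by apply: eq_bigr => i _; rewrite csym.
rewrite mul2n -addnn -{1}flip -!big_split; apply: eq_bigr => i _ /=.
rewrite (bigD1 i) //=; congr (_ + _).
rewrite (bigID (fun j : 'I_n => j < i)) /=; congr (_ + _); apply: eq_bigl => j.
  by rewrite -val_eqE /=; lia.
by rewrite -val_eqE /=; lia.
Qed.

(** The sum over i < j refers to positions; doubling it and adding the diagonal gives a sum over all
    pairs of parts, visibly independent of their order. *)
Lemma zeta_offdiag lam (c := fun k l => (1 + ee2 k l) * gcdn k l) :
  2 * \sum_(i < size lam) \sum_(j < size lam | i < j) c (nth 0 lam i) (nth 0 lam j)
   + \sum_(k <- lam) c k k = \sum_(k <- lam) \sum_(l <- lam) c k l.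
Proof.
have csym i j : c (nth 0 lam i) (nth 0 lam j) = c (nth 0 lam j) (nth 0 lam i).
  by rewrite /c gcdnC /ee2 orbC.
rewrite -(big_nth_ord lam (fun k => \sum_(l <- lam) c k l)).
under [RHS]eq_bigr => i _ do rewrite -(big_nth_ord lam (c _)).
by rewrite (sum_sym_lt _ csym) addnC -(big_nth_ord lam (fun k => c k k)).
Qed.

Lemma perm_beta l1 l2 : perm_eq l1 l2 -> beta l1 = beta l2.
Proof.
move=> pl; rewrite !beta_seq (perm_big _ pl); apply: eq_bigr => k _.
exact: perm_big.
Qed.

Lemma perm_eta l1 l2 : perm_eq l1 l2 -> eta l1 = eta l2.
Proof. by move=> pl; rewrite !eta_seq (perm_big _ pl). Qed.

Lemma perm_zeta l1 l2 : perm_eq l1 l2 -> zeta l1 = zeta l2.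
Proof.
move=> pl; rewrite /zeta; congr (_ %/ 2 + _).
  pose F k := (1 + ee k) * (k + 1) - 2 * (ff k + 1).
  by rewrite !(big_nth_ord _ F); exact: perm_big.
pose c k l := (1 + ee2 k l) * gcdn k l.
have E1 : \sum_(k <- l1) c k k = \sum_(k <- l2) c k k by exact: perm_big.
have E2 : \sum_(k <- l1) \sum_(l <- l1) c k l = \sum_(k <- l2) \sum_(l <- l2) c k l.
  by rewrite (perm_big _ pl); apply: eq_bigr => k _; exact: perm_big.
have /eqP := etrans (zeta_offdiag l1) (etrans E2 (esym (zeta_offdiag l2))).
by rewrite E1 eqn_add2r eqn_pmul2l // => /eqP.
Qed.

Section RationalCounts.

Local Open Scope ring_scope.

(** A cycle of length k carrying odd pairs has k of them. This is what they would add to the number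
    of even orbits if each lay on an orbit of length lcm(2, k): k/(2k) for odd k, k/k for k equal to
    2 mod 4. *)
Definition odd_defect k : rat :=
  if odd k then 2^-1 else if (k %% 4 == 2)%N then 1 else 0.

Lemma zeta_seq lam : all (fun k => (0 < k)%N) lam ->
  (zeta lam)%:R =
  \sum_(k <- lam) \sum_(l <- lam) 2^-1 * ((1 + ee2 k l) * gcdn k l)%:R
  - \sum_(k <- lam) odd_defect k.
Proof.
move=> pos; rewrite zetaE //.
pose c k l := ((1 + ee2 k l) * gcdn k l)%N.
have -> : \sum_(i < size lam) \sum_(j < size lam | (i < j)%N)
    (1 + (ee2 (nth 0%N lam i) (nth 0%N lam j))%:R) *
    (gcdn (nth 0%N lam i) (nth 0%N lam j))%:R =
  (\sum_(i < size lam) \sum_(j < size lam | i < j) c (nth 0 lam i) (nth 0 lam j))%N%:R :> rat.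
  rewrite natr_sum; apply: eq_bigr => i _; rewrite natr_sum.
  by apply: eq_bigr => j _; rewrite natrM natrD.
have -> : \sum_(k <- lam) \sum_(l <- lam) 2^-1 * (c k l)%:R =
    2^-1 * (\sum_(k <- lam) \sum_(l <- lam) c k l)%N%:R :> rat.
  rewrite natr_sum mulr_sumr; apply: eq_bigr => k _.
  by rewrite natr_sum mulr_sumr.
rewrite -(zeta_offdiag lam) natrD natrM.
rewrite (big_nth_ord lam (fun k => (1 + (ee k)%:R) * (k%:R + 1) - 2 * ((ff k)%:R + 1))).
have -> : \sum_(k <- lam) ((1 + (ee k)%:R) * (k%:R + 1) - 2 * ((ff k)%:R + 1)) =
  (\sum_(k <- lam) (1 + ee2 k k) * gcdn k k)%N%:R - 2 * \sum_(k <- lam) odd_defect k :> rat.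
  rewrite natr_sum mulr_sumr -sumrB; apply: eq_bigr => k _.
  rewrite gcdnn /ee2 orbb natrM natrD /odd_defect /ee /ff.
  have [ok|nok] := boolP (odd k) => /=.
    have -> : (k %% 4 == 2)%N = false by lia.
    by rewrite /=; field.
  by case: eqP => _ /=; ring.
by field.
Qed.

(** Use k l = lcm(k, l) gcd(k, l); the extra factor 2 changes the lcm only when k and l are both
    odd. *)
Lemma lcm2_ratio k l : (0 < k)%N -> (0 < l)%N ->
  k%:R * l%:R * (lcmn 2 (lcmn k l))%:R^-1 = 2^-1 * ((1 + ee2 k l) * gcdn k l)%:R :> rat.
Proof.
move=> k0 l0; rewrite -natrM -muln_lcm_gcd natrM.
have L0 : (lcmn k l)%:R != 0 :> rat by rewrite pnatr_eq0 -lt0n lcmn_gt0 k0.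
have -> : lcmn 2 (lcmn k l) = if ee2 k l == 1%N then lcmn k l else (2 * lcmn k l)%N.
  rewrite /ee2; case: ifPn => e.
    apply/lcmn_idPr; move: e; rewrite eqb1 => /orP[] ev.
      by apply: dvdn_trans (dvdn_lcml _ _); rewrite dvdn2.
    by apply: dvdn_trans (dvdn_lcmr _ _); rewrite dvdn2.
  rewrite /lcmn (eqP (_ : gcdn 2 _ == 1)%N) ?divn1 // -/(coprime _ _) coprime2n.
  move: e; rewrite eqb1 negb_or !negbK => /andP[ok ol].
  apply: contraT => nL.
  have : (2 %| k * l)%N by rewrite -muln_lcm_gcd dvdn_mulr // dvdn2.
  by rewrite dvdn2 oddM ok ol.
by rewrite /ee2; case: (_ || _) => /=; rewrite !natrM ?natrD; field.
Qed.

Lemma lcm_ratio k l : (0 < k)%N -> (0 < l)%N ->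
  k%:R * l%:R * (lcmn k l)%:R^-1 = (gcdn k l)%:R :> rat.
Proof.
move=> k0 l0; rewrite -natrM -muln_lcm_gcd natrM.
have L0 : (lcmn k l)%:R != 0 :> rat by rewrite pnatr_eq0 -lt0n lcmn_gt0 k0.
by field.
Qed.

(** * Numbers of orbits in terms of the cycle type *)

Section OrbitCounts.

Variables (T : finType) (A : {set T}) (g : {perm T}).
Hypothesis gA : perm_on A g.

Let ct := cycle_type A g.

Lemma cycle_type_pos : all (fun k => (0 < k)%N) ct.
Proof.
by apply/allP => _ /imageP[_ /imsetP[x _ ->] ->]; rewrite card_cyc fingraph.order_gt0.
Qed.

Let stA b : {in pair_dom A, forall u, pair_act b g u \in pair_dom A}.
Proof. by apply: pair_act_dom => x; rewrite perm_closed. Qed.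

Let sum2 (F : nat -> nat -> rat) :
  \sum_(x in A) \sum_(y in A) F (fingraph.order g x) (fingraph.order g y) =
  \sum_(k <- ct) \sum_(l <- ct) k%:R * l%:R * F k l.
Proof.
rewrite (eq_bigr (fun x => \sum_(l <- ct) F (fingraph.order g x) l *+ l)); last first.
  by move=> x _; rewrite -sum_cycle_type.
rewrite (sum_cycle_type (fun k => \sum_(l <- ct) F k l *+ l) gA).
apply: eq_bigr => k _; rewrite -[LHS]mulr_natl mulr_sumr; apply: eq_bigr => l _.
by rewrite -[F k l *+ l]mulr_natl mulrA.
Qed.

(** Two cycles of lengths k and l give gcd(k, l) orbits of pairs; the added 1 is the orbit of
    [None]. *)
Lemma card_orbits_pairs :
  #|orbits_with (pair_act false g) (pair_dom A) predT| = (beta ct + 1)%N.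
Proof.
apply/eqP; rewrite -(eqr_nat rat) card_orbits_with //; last exact: pair_act_inj.
rewrite sum_pair_dom /= order_pair_act_none invr1 natrD addrC.
under eq_bigr => x _ do under eq_bigr => y _ do rewrite order_pair_act0.
rewrite (sum2 (fun k l => (lcmn k l)%:R^-1)) beta_seq natr_sum.
rewrite (eq_big_seq (fun k => (\sum_(l <- ct) gcdn k l)%N%:R)) // => k kc.
rewrite natr_sum; apply: eq_big_seq => l lc; apply: lcm_ratio.
  exact: (allP cycle_type_pos).
exact: (allP cycle_type_pos).
Qed.

Let odd_pair_count k : rat := (odd k || (k %% 4 == 2)%N)%:R.

Let sum_odd_pair (F : nat -> rat) :
  \sum_(x in A) \sum_(y in A) (if odd_pair g x y then F (fingraph.order g x) else 0) =
  \sum_(k <- ct) k%:R * (odd_pair_count k * F k).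
Proof.
rewrite (eq_bigr (fun x => odd_pair_count (fingraph.order g x) * F (fingraph.order g x))).
  rewrite (sum_cycle_type (fun k => odd_pair_count k * F k) gA).
  by apply: eq_bigr => k _; rewrite -[LHS]mulr_natl.
move=> x xA; set k := fingraph.order g x.
(* The only possible partner of [x] in an odd pair. *)
pose y0 := if odd k then x else iter k./2 g x.
have y0A : y0 \in A.
  rewrite /y0; case: ifP => // _; elim: (k./2) => //= j; by rewrite perm_closed.
rewrite (bigD1 y0) //= big1 ?addr0 => [|y /andP[_ ny]].
  rewrite /odd_pair /odd_pair_count -/k /y0.
  by case: (odd k) => /=; rewrite ?eqxx ?mul1r //= andbT; case: ifP; rewrite ?mul1r ?mul0r.
rewrite ifN // /odd_pair -/k; apply: contra ny; rewrite /y0.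
case: ifP => [ok /orP[//|/andP[/eqP]]|_ /=]; first by lia.
by case/andP.
Qed.

(** The k odd pairs on a cycle of length k form one orbit if k is odd and two orbits of length k/2
    if k is 2 mod 4. The added 1 is again [None]. *)
Lemma card_odd_orbits :
  #|orbits_with (pair_act true g) (pair_dom A) odd| = (eta ct + 1)%N.
Proof.
apply/eqP; rewrite -(eqr_nat rat) card_orbits_with //; last exact: pair_act_inj.
rewrite sum_pair_dom /= order_pair_act_none invr1 natrD addrC.
rewrite (eq_bigr (fun x => \sum_(y in A) (if odd_pair g x y then
    (odd_len (fingraph.order g x))%:R^-1 else 0))) => [|x _]; last first.
  apply: eq_bigr => y _; rewrite order_pair_act1; case: (boolP (odd_pair g x y)) => sp; last first.
    by have /negbTE-> : ~~ odd (lcmn 2 (lcmn (fingraph.order g x) (fingraph.order g y)));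
      rewrite // -dvdn2 dvdn_lcml.
  rewrite ifT //; move: sp; rewrite /odd_pair /odd_len; case: ifP => //= _; lia.
rewrite (sum_odd_pair (fun k => (odd_len k)%:R^-1)) eta_seq natr_sum.
apply/eqP; congr (_ + _); apply: eq_big_seq => k kc.
have k0 := allP cycle_type_pos _ kc.
rewrite /odd_pair_count /odd_len /ee /ff; case: (boolP (odd k)) => ok /=.
  have -> : (k %% 4 == 2)%N = false by lia.
  by rewrite mul1r mulfV // pnatr_eq0 -lt0n.
case: eqP => k2 /=; last by rewrite mul0r mulr0.
have {1}-> : k = (2 * k./2)%N by lia.
by rewrite mul1r natrM mulfK // pnatr_eq0; lia.
Qed.

(** Treat every pair as lying on an orbit of length lcm(2, k, l), then subtract the share of the odd
    pairs, [odd_defect] for each cycle. [None] is an odd orbit and adds nothing. *)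
Lemma card_even_orbits :
  #|orbits_with (pair_act true g) (pair_dom A) (fun n => ~~ odd n)| = zeta ct.
Proof.
apply/eqP; rewrite -(eqr_nat rat) card_orbits_with //; last exact: pair_act_inj.
rewrite sum_pair_dom /= order_pair_act_none add0r zeta_seq ?cycle_type_pos //.
pose F k l : rat := (lcmn 2 (lcmn k l))%:R^-1.
rewrite (eq_bigr (fun x => \sum_(y in A) (F (fingraph.order g x) (fingraph.order g y) -
   (if odd_pair g x y then F (fingraph.order g x) (fingraph.order g x) else 0)))) => [|x _]; last first.
  apply: eq_bigr => y _; rewrite order_pair_act1; case: (boolP (odd_pair g x y)) => sp; last first.
    by have -> : ~~ odd (lcmn 2 (lcmn (fingraph.order g x) (fingraph.order g y)));
      rewrite ?subr0 // -dvdn2 dvdn_lcml.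
  have -> : fingraph.order g y = fingraph.order g x.
    by case/orP: sp => /andP[_ /eqP ->] //; rewrite order_iter.
  rewrite subrr ifN // negbK; move: sp; rewrite /odd_pair /odd_len; case: ifP => //= _; lia.
under eq_bigr => x _ do rewrite sumrB.
rewrite sumrB sum2 (sum_odd_pair (fun k => F k k)); apply/eqP; congr (_ - _).
  apply: eq_big_seq => k kc; apply: eq_big_seq => l lc.
  by rewrite lcm2_ratio ?(allP cycle_type_pos).
apply: eq_big_seq => k kc; have k0 := allP cycle_type_pos _ kc.
have := lcm2_ratio k0 k0; rewrite -/(F k k) gcdnn /ee2 orbb => e.
have k0' : k%:R != 0 :> rat by rewrite pnatr_eq0 -lt0n.
have -> : k%:R * (odd_pair_count k * F k k) = odd_pair_count k * (k%:R * k%:R * F k k) / k%:R.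
  by field.
rewrite e /odd_pair_count /odd_defect; case: (boolP (odd k)) => ok /=.
  by rewrite natrM; field.
by case: eqP => _ /=; rewrite natrM; field.
Qed.

End OrbitCounts.

End RationalCounts.

(** * 3-nilpotent semigroups as surjections *)

Section Nilpotent3.

Variable T : finType.
Implicit Types (S : binop T) (A : {set T}) (f : {perm T}) (b : bool).

Definition prods S : {set T} := [set S p.1 p.2 | p in [set: T * T]].

Lemma mem_prods S x y : S x y \in prods S.
Proof. by apply/imsetP; exists (x, y); rewrite ?inE. Qed.

Lemma prodsP S z : reflect (exists x y, z = S x y) (z \in prods S).
Proof.
apply: (iffP imsetP) => [[[x y] _ ->]|[x [y ->]]]; first by exists x, y.
by exists (x, y); rewrite ?inE.
Qed.

(** Associativity is absorbed: if every product with a factor in S^2 is o, both bracketings of a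
    triple equal o. *)
Lemma nilpotent3P S : reflect
  (exists2 o, (forall x y, (x \in prods S) || (y \in prods S) -> S x y = o)
            & o \in prods S /\ 1 < #|prods S|)
  (nilpotent3 S).
Proof.
apply: (iffP andP) => [[sgS /existsP[o /and3P[zo nil ne]]]|[o ho [oS cS]]].
  have assoc x y z : S x (S y z) = S (S x y) z.
    by move/forallP/(_ x)/forallP/(_ y)/forallP/(_ z)/eqP: sgS.
  have nil3 x y z : S (S x y) z = o.
    by move/forallP/(_ x)/forallP/(_ y)/forallP/(_ z)/eqP: nil.
  have oo : o \in prods S.
    by rewrite -[o](_ : S (S o o) o = o) ?mem_prods.
  exists o => [x y /orP[/prodsP[u [v ->]]|/prodsP[u [v ->]]]|]; rewrite ?assoc //.
  split=> //; case/existsP: ne => u /existsP[v ne].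
  rewrite (cardD1 o) oo (cardD1 (S u v)) !inE ne mem_prods //.
split.
  apply/forallP => x; apply/forallP => y; apply/forallP => z.
  by rewrite (ho x (S y z)) ?(ho (S x y) z) ?mem_prods ?orbT.
apply/existsP; exists o; apply/and3P; split.
- by apply/forallP => x; rewrite (ho o x) ?(ho x o) ?oS ?orbT ?eqxx.
- apply/forallP => x; apply/forallP => y; apply/forallP => z.
  by rewrite (ho (S x y) z) ?mem_prods ?eqxx.
- have : 0 < #|prods S :\ o| by move: cS; rewrite (cardsD1 o) oS.
  case/card_gt0P => z; rewrite !inE => /andP[zo /prodsP[u [v zE]]].
  by apply/existsP; exists u; apply/existsP; exists v; rewrite -zE.
Qed.

(** Products of pairs from [A] are free; all others are the zero, stored as the value at [None]. *)
Definition op_of A (p : {ffun option (T * T) -> T}) : binop T :=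
  [ffun x => [ffun y => if (x \in A) && (y \in A) then p (Some (x, y)) else p None]].

Definition twist b S := if b then dual S else S.

Lemma twistE b S x y : twist b S x y = if b then S y x else S x y.
Proof. by case: b; rewrite //= !ffunE. Qed.

(** [op_of A] is a bijection: surjectivity onto [~: A] says that S^2 is [~: A], and equivariance
    says that [f] is an automorphism or anti-automorphism, according to [b]. *)
Lemma card_nilpotent3_fixed A b f y0 : 1 < #|~: A| -> stableb f A ->
  #|[set S | [&& nilpotent3 S, prods S == ~: A & iso_by f (twist b S) S]]| =
  #|[set p in pffun_on y0 (mem (pair_dom A)) (mem (~: A))
      | equivariant (pair_act b f) f (pair_dom A) p & p @: pair_dom A == ~: A]|.
Proof.
move=> cA stA; have fA x : (f x \in A) = (x \in A).
  by apply: (astabsP (stableb_astabs stA)).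
(* A point outside [A]; its square is the zero and reveals the value at [None]. *)
have [y1 y1A] : exists y1, y1 \in ~: A by apply/card_gt0P/ltnW.
have {}y1A : y1 \notin A by rewrite inE in y1A.
rewrite -[RHS](card_in_imset (f := op_of A)); last first.
  move=> p1 p2; rewrite !inE => /andP[/pffun_onP[/supportP s1 _] _].
  move=> /andP[/pffun_onP[/supportP s2 _] _] /ffunP e.
  have {}e x y : op_of A p1 x y = op_of A p2 x y by rewrite e.
  apply/ffunP => u; have [uD|uD] := boolP (u \in pair_dom A); last by rewrite s1 ?s2.
  case: u uD => [[x y]|] uD; last by have := e y1 y1; rewrite !ffunE (negbTE y1A).
  by move: uD; rewrite inE => uD; have := e x y; rewrite !ffunE uD.
apply: eq_card => S; apply/idP/imsetP.
- rewrite inE => /and3P[/nilpotent3P[o ho [oS cS]] /eqP sqS /iso_byP isoS].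
  have Sout x y : ~~ ((x \in A) && (y \in A)) -> S x y = o.
    by move=> nA; apply: ho; rewrite sqS !inE -negb_and.
  pose p : {ffun option (T * T) -> T} := [ffun u => if u \in pair_dom A then
      (if u is Some (x, y) then S x y else o) else y0].
  have op : op_of A p = S.
    apply/ffunP => x; apply/ffunP => y; rewrite !ffunE !inE.
    by case xy: ((x \in A) && (y \in A)); rewrite ?xy //= Sout ?xy.
  have imp : p @: pair_dom A = ~: A.
    rewrite -sqS; apply/setP => z; apply/imsetP/prodsP => [[u uD ->]|[x [y ->]]].
      rewrite ffunE uD; case: u uD => [[x y]|] _; first by exists x, y.
      exact/prodsP.
    have [xy|/Sout ->] := boolP ((x \in A) && (y \in A)); last first.
      by exists None; rewrite ?ffunE inE.
    by exists (Some (x, y)); rewrite ?ffunE !inE ?xy.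
  exists p => //; rewrite inE imp eqxx andbT; apply/andP; split.
    apply/pffun_onP; split=> [|_ /imageP[u uD ->]].
      by apply/supportP => u uD; rewrite ffunE (negbTE uD).
    by rewrite -imp; exact: imset_f.
  have fo : f o = o.
    have Syy : S y1 y1 = o by rewrite Sout // (negbTE y1A).
    have := isoS y1 y1; rewrite twistE if_same Syy => ->.
    by rewrite Sout // fA (negbTE y1A).
  apply/forall_inP => u uD; rewrite ffunE (pair_act_dom _ _ uD); last first.
    by move=> x; rewrite fA.
  rewrite ffunE uD; case: u uD => [[x y]|] _ /=; last by rewrite fo.
  by case: b isoS {op imp p} => isoS /=; [have := isoS y x | have := isoS x y]; rewrite twistE => ->.
- case=> p; rewrite [p \in _]inE => /and3P[/pffun_onP[/supportP sp imp] /forall_inP eqp /eqP sqp] ->.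
  have opE x y : op_of A p x y = if (x \in A) && (y \in A) then p (Some (x, y)) else p None.
    by rewrite !ffunE.
  have NoneD : None \in pair_dom A by rewrite inE.
  have sq : prods (op_of A p) = ~: A.
    rewrite -sqp; apply/setP => z; apply/prodsP/imsetP => [[x [y ->]]|[u uD ->]].
      rewrite opE; case: ifP => xy; last by exists None.
      by exists (Some (x, y)); rewrite ?inE.
    case: u uD => [[x y]|] uD; last by exists y1, y1; rewrite opE (negbTE y1A).
    by exists x, y; move: uD; rewrite opE inE => ->.
  rewrite inE sq eqxx /=; apply/andP; split.
    apply/nilpotent3P; exists (p None) => [x y|].
      by rewrite sq !inE -negb_and opE => /negbTE->.
    by rewrite sq -{1}sqp imset_f.
  have fo : f (p None) = p None by have := eqp _ NoneD => /eqP.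
  apply/iso_byP => x y; rewrite twistE.
  have eqS u v : u \in A -> v \in A ->
     p (pair_act b f (Some (u, v))) = f (p (Some (u, v))).
    by move=> uA vA; apply/eqP; apply: eqp; rewrite inE uA.
  rewrite !opE !fA; case: b eqS {eqp} => /= eqS.
    by rewrite andbC; case: ifP => [/andP[xA yA]|] //; rewrite -eqS.
  by case: ifP => [/andP[xA yA]|] //; rewrite -eqS.
Qed.

Lemma card_orbits_agree (U : finType) (h1 h2 : U -> U) (D : {set U}) (q : pred nat) :
  injective h1 -> injective h2 -> {in D, forall u, h1 u \in D} -> {in D, h1 =1 h2} ->
  #|orbits_with h1 D q| = #|orbits_with h2 D q|.
Proof.
move=> i1 i2 st ag; apply/eqP; rewrite -(eqr_nat rat) !card_orbits_with //; last first.
  by move=> u uD; rewrite -ag ?st.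
apply/eqP/eq_bigr => u uD; suff -> : fingraph.order h1 u = fingraph.order h2 u by [].
by apply: eq_card => v; rewrite !inE (fconnect_agree st ag uD).
Qed.

(** * Semigroups fixed by a given permutation *)

Section FixedCounts.

Variables (A : {set T}) (g s : {perm T}).
Hypotheses (cA : 1 < #|~: A|) (gA : perm_on A g) (sA : perm_on (~: A) s).

Let dis : [disjoint A & ~: A].
Proof. by apply/pred0P => x /=; rewrite inE andbN. Qed.

Let gsE x : (g * s)%g x = if x \in A then g x else s x.
Proof. exact: permM_on gA sA dis. Qed.

Let stA : stableb (g * s)%g A.
Proof. by apply/stableP => x xA; rewrite gsE xA perm_closed. Qed.

Let stY : stableb (g * s)%g (~: A).
Proof.
apply/stableP => x xA; rewrite gsE ifN; first by rewrite perm_closed.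
by rewrite inE in xA.
Qed.

Let sE x : x \in ~: A -> (g * s)%g x = s x.
Proof. by rewrite inE gsE => /negbTE->. Qed.

Let card_orb b q : #|orbits_with (pair_act b (g * s)%g) (pair_dom A) q| =
  #|orbits_with (pair_act b g) (pair_dom A) q|.
Proof.
apply: card_orbits_agree; try exact: pair_act_inj.
  by apply: pair_act_dom => x; exact: (stableP _ _ stA).
case=> [[x y]|] //; rewrite inE => /andP[xA yA] /=.
by rewrite !gsE xA yA.
Qed.

(** The target has only fixed points, so [mixed_surj0] applies and even and odd orbits are counted
    together. *)
Lemma card_automorphic :
  {in ~: A, forall y, (g * s)%g y = y} ->
  #|[set S | [&& nilpotent3 S, prods S == ~: A & iso_by (g * s)%g (twist false S) S]]| =
  #|~: A|`! * stirling2 (beta (cycle_type A g) + 1) #|~: A|.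
Proof.
move=> fK; have [y0 _] : exists y, y \in ~: A by apply/card_gt0P/ltnW.
rewrite (card_nilpotent3_fixed _ y0) // card_equivariant_onto //.
- have -> : lowpts (g * s)%g (~: A) = set0.
    by apply/setP => y; rewrite inE in_set0; case yA: (y \in ~: A); rewrite //= fK // ltnn.
  have -> : fixpts (g * s)%g (~: A) = ~: A.
    by apply/setP => y; rewrite inE; case yA: (y \in ~: A); rewrite //= fK // eqxx.
  have E : #|orbits_with (pair_act false g) (pair_dom A) (fun n => ~~ odd n)| +
      #|orbits_with (pair_act false g) (pair_dom A) odd| =
      #|orbits_with (pair_act false g) (pair_dom A) predT|.
    rewrite -(cardsID [set u | odd (fingraph.order (pair_act false g) u)]
               (orbits_with _ _ predT)) addnC.
    by congr (_ + _); apply: eq_card => u; rewrite !inE; case: (odd _); rewrite ?andbT ?andbF.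
  rewrite (@cards0 T) mixed_surj0 (card_orb false odd).
  by rewrite (card_orb false (fun n => ~~ odd n)) E card_orbits_pairs.
- exact: pair_act_inj.
- by apply: pair_act_dom => x; exact: (stableP _ _ stA).
- by move=> y yA; rewrite !fK.
Qed.

Lemma card_antiautomorphic :
  {in ~: A, forall y, s (s y) = y} ->
  #|[set S | [&& nilpotent3 S, prods S == ~: A & iso_by (g * s)%g (twist true S) S]]| =
  mixed_surj (zeta (cycle_type A g)) (eta (cycle_type A g) + 1)
    (#|~: A| - #|lowpts s (~: A)|.*2) #|lowpts s (~: A)|.
Proof.
move=> sK; have [y0 _] : exists y, y \in ~: A by apply/card_gt0P/ltnW.
have fK : {in ~: A, forall y, (g * s)%g ((g * s)%g y) = y}.
  by move=> y yA; rewrite !sE ?sK // perm_closed.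
rewrite (card_nilpotent3_fixed _ y0) // card_equivariant_onto //.
- have <- : lowpts (g * s)%g (~: A) = lowpts s (~: A).
    by apply/setP => y; rewrite !inE; case yA: (y \in A); rewrite //= sE ?inE ?yA.
  rewrite (card_orb true odd) (card_orb true (fun n => ~~ odd n)).
  rewrite (card_even_orbits gA) (card_odd_orbits gA).
  by rewrite (card_fix_low fK stY) mul2n addnK.
- exact: pair_act_inj.
- by apply: pair_act_dom => x; exact: (stableP _ _ stA).
Qed.

End FixedCounts.

End Nilpotent3.

(** * Burnside counting for relabelling and duality *)

Section Burnside.

Variable T : finType.
Implicit Types (S : binop T) (f : {perm T}) (b : bool).

(** The pair (b, f) is an element of the direct product of a group of order 2 and the symmetric
    group on [T]; [b] tells whether products are reversed. *)
Definition moves b f S1 S2 := iso_by f (twist b S1) S2.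

Definition image b f S : binop T :=
  [ffun x => [ffun y => f (twist b S (f^-1%g x) (f^-1%g y))]].

Lemma movesE b f S1 S2 : moves b f S1 S2 = (S2 == image b f S1).
Proof.
apply/iso_byP/eqP => [h|-> x y]; last by rewrite !ffunE !permK.
by apply/ffunP => x; apply/ffunP => y; rewrite !ffunE h !permKV.
Qed.

Lemma moves_comp b f S1 S2 c h S3 :
  moves b f S1 S2 -> moves c h S2 S3 -> moves (b (+) c) (f * h)%g S1 S3.
Proof.
move=> /iso_byP m1 /iso_byP m2; apply/iso_byP => x y; rewrite !permM -m2; congr (h _).
by case: c {m2}; rewrite !twistE -m1 !twistE; case: (b).
Qed.

Lemma moves_inv b f S1 S2 : moves b f S1 S2 -> moves b f^-1%g S2 S1.
Proof.
move=> /iso_byP m; apply/iso_byP => x y; apply: (@perm_inj _ f).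
rewrite permKV twistE; have := m (f^-1%g x) (f^-1%g y); have := m (f^-1%g y) (f^-1%g x).
by rewrite !twistE !permKV; case: (b) => [-> _|_ ->].
Qed.

Lemma sg_equivP S1 S2 : reflect (exists b f, moves b f S1 S2) (sg_equiv S1 S2).
Proof.
apply: (iffP orP) => [[/existsP[f m]|/existsP[f m]]|[[] [f m]]].
- by exists false, f.
- by exists true, f.
- by right; apply/existsP; exists f.
- by left; apply/existsP; exists f.
Qed.

Definition sg_closed (P : pred (binop T)) :=
  forall b f S1 S2, moves b f S1 S2 -> P S1 -> P S2.

(** In the class of [S0], the stabiliser of S has as many elements as there are moves from [S0] to
    S. Summed over the class, these moves exhaust the group, of order 2 n!. *)
Lemma burnside_moves (P : pred (binop T)) : sg_closed P ->
  \sum_(S | P S) #|[set p : bool * {perm T} | moves p.1 p.2 S S]| =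
  #|equivalence_partition (@sg_equiv T) [set S | P S]| * (2 * #|T|`!).
Proof.
move=> clP; set X := [set S | P S].
have eqR := @sg_equiv_equivalence T.
have pX : partition (equivalence_partition (@sg_equiv T) X) X.
  by apply: equivalence_partitionP => x y z _ _ _; exact: eqR.
rewrite (eq_bigl (fun S => S \in X)); last by move=> S; rewrite inE.
rewrite (set_partition_big _ pX) /= -sum_nat_const.
apply: eq_bigr => C /imsetP[S0 S0X ->].
have stabE S : sg_equiv S0 S ->
    #|[set p : bool * {perm T} | moves p.1 p.2 S S]| =
    #|[set p : bool * {perm T} | moves p.1 p.2 S0 S]|.
  case/sg_equivP=> b0 [f0 m0].
  (* Compose a stabilising move of [S] with a fixed move from [S0] to [S]. *)
  pose phi (p : bool * {perm T}) := (b0 (+) p.1, (f0 * p.2)%g).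
  have phi_inj : injective phi by move=> [b f] [b' f'] [/addbI -> /mulgI ->].
  rewrite -(card_preimset [set p : bool * {perm T} | moves p.1 p.2 S0 S] phi_inj).
  apply: eq_card => -[b f]; rewrite !inE /=.
  have m : moves b f S (image b f S) by rewrite movesE.
  by have := moves_comp m0 m; rewrite !movesE => /eqP->.
transitivity (\sum_(S in [set y in X | sg_equiv S0 y])
   \sum_(p : bool * {perm T} | moves p.1 p.2 S0 S) 1).
  apply: eq_bigr => S; rewrite inE => /andP[_ /stabE->].
  by rewrite -sum1_card; apply: eq_bigl => p; rewrite inE.
rewrite (exchange_big_dep predT) //=.
have cP : #|{: bool * {perm T}}| = 2 * #|T|`!.
  rewrite card_prod card_bool -(cardsT T) -(card_perm [set: T]); congr (_ * _).
  by apply: eq_card => f; rewrite !inE; apply/esym/subsetP => x; rewrite inE.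
rewrite -cP -sum1_card; apply: eq_bigr => -[b f] _ /=.
rewrite (big_pred1 (image b f S0)) // => S; rewrite inE /= -movesE.
case m: (moves b f S0 S); rewrite ?andbF // andbT inE.
apply/andP; split; first by apply: clP m _; rewrite inE in S0X.
by apply/sg_equivP; exists b, f.
Qed.

Lemma moves_prods b f S1 S2 z : moves b f S1 S2 -> (f z \in prods S2) = (z \in prods S1).
Proof.
move=> /iso_byP m; apply/prodsP/prodsP => -[x [y e]].
  have := m (f^-1%g x) (f^-1%g y); rewrite !permKV -e => /perm_inj <-.
  by rewrite twistE; case: (b); [exists (f^-1%g y), (f^-1%g x) | exists (f^-1%g x), (f^-1%g y)].
case: (b) m => m; first by exists (f y), (f x); rewrite -m twistE e.
by exists (f x), (f y); rewrite -m twistE e.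
Qed.

Lemma nilpotent3_closed : sg_closed (@nilpotent3 T).
Proof.
move=> b f S1 S2 m /nilpotent3P[o ho [oS cS]]; apply/nilpotent3P; exists (f o).
  move=> x y; rewrite -{1}(permKV f x) -{1}(permKV f y) !(moves_prods _ m) => h.
  have /iso_byP/(_ (f^-1%g x) (f^-1%g y)) := m; rewrite !permKV => <-.
  by rewrite twistE; congr (f _); case: (b); apply: ho; rewrite // orbC.
rewrite (moves_prods _ m); split=> //.
have -> : prods S2 = f @: prods S1.
  apply/setP => z; rewrite -(permKV f z) (moves_prods _ m).
  by rewrite mem_imset //; exact: perm_inj.
by rewrite card_imset //; exact: perm_inj.
Qed.

Lemma semirigidP S : reflect
  (forall f, moves false f S S -> {in prods S, forall z, f z = z}) (semirigid S).
Proof.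
apply: (iffP forallP) => [sr f m z /prodsP[x [y ->]]|sr f].
  by have /implyP/(_ m)/forallP/(_ x)/forallP/(_ y)/eqP := sr f.
apply/implyP => m; apply/forallP => x; apply/forallP => y; apply/eqP.
by apply: sr => //; exact: mem_prods.
Qed.

Lemma semirigid_closed : sg_closed (@semirigid T).
Proof.
move=> b f S1 S2 m /semirigidP sr; apply/semirigidP => h mh z zS.
(* Conjugating the automorphism [h] of [S2] gives an automorphism of [S1]: the two possible
   reversals cancel. *)
have := moves_comp (moves_comp m mh) (moves_inv m); rewrite addbF addbb => /sr.
move/(_ (f^-1%g z)); rewrite -(moves_prods _ m) permKV => /(_ zS).
by rewrite !permM permKV => /perm_inj.
Qed.

Definition fixes_prods b f S :=
  [forall (y | y \in prods S), (if b then f (f y) else f y) == y].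

Lemma semirigid_fixes b f S : semirigid S -> moves b f S S -> fixes_prods b f S.
Proof.
move=> /semirigidP sr m; apply/forall_inP => y yS.
case: b m => m; last by rewrite sr.
by have /sr/(_ y yS) := moves_comp m m; rewrite permM => ->.
Qed.

Definition restricted_fixed : nat :=
  \sum_(S | nilpotent3 S)
    #|[set p : bool * {perm T} | moves p.1 p.2 S S && fixes_prods p.1 p.2 S]|.

Lemma restricted_fixed_le :
  restricted_fixed <=
  #|equivalence_partition (@sg_equiv T) [set S | nilpotent3 S]| * (2 * #|T|`!).
Proof.
rewrite -(burnside_moves nilpotent3_closed); apply: leq_sum => S _.
by apply/subset_leq_card/subsetP => p; rewrite !inE => /andP[].
Qed.

Lemma restricted_fixed_ge :
  #|equivalence_partition (@sg_equiv T) [set S | nilpotent3 S && semirigid S]|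
    * (2 * #|T|`!) <= restricted_fixed.
Proof.
rewrite -(burnside_moves (P := fun S => nilpotent3 S && semirigid S)); last first.
  move=> b f S1 S2 m /andP[n1 s1].
  by rewrite (nilpotent3_closed m n1) (semirigid_closed m s1).
rewrite big_mkcondr; apply: leq_sum => S _; case: ifP => // sr.
apply/subset_leq_card/subsetP => p; rewrite !inE => m.
by rewrite m semirigid_fixes.
Qed.

End Burnside.

Local Open Scope ring_scope.

(** * Assembling the formula *)

Section Assembly.

Lemma sum_nat_trunc (V : nmodType) (c a b : nat) (F : nat -> V) : (c <= a <= b)%N ->
  (forall t, (a <= t < b)%N -> F t = 0) -> \sum_(c <= t < b) F t = \sum_(c <= t < a) F t.
Proof.
move=> /andP[ca ab] F0; rewrite (big_cat_nat ca ab) /= [X in _ + X]big_nat.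
by rewrite [X in _ + X]big1 ?addr0 // => t /F0.
Qed.

(** The weights of [sum_involutions] cancel the factorials in [mixed_surj] and turn 2^j into
    2^(j-t), which gives [acoef]. *)
Lemma mixed_surj_enum z e m : (0 < m)%N ->
  \sum_(0 <= t < (m./2).+1)
    (mixed_surj z (e + 1) (m - t.*2) t)%:R / (2 ^ t * t`! * (m - t.*2)`!)%:R =
  (\sum_(0 <= j < z.+1) 'C(z, j) *
     \sum_(0 <= t < (minn j ((m - 1) %/ 2)).+1)
       acoef j t * stirling2 (z + e - j + 1) (m - 2 * t))%N%:R :> rat.
Proof.
move=> m0.
transitivity (\sum_(0 <= j < z.+1) \sum_(0 <= t < (m./2).+1)
   ('C(z, j) * (acoef j t * stirling2 (z + e - j + 1) (m - 2 * t)))%N%:R : rat).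
  rewrite exchange_big_nat /=; apply: eq_bigr => t _.
  rewrite /mixed_surj natr_sum mulr_suml [RHS]big_mkord.
  apply: eq_bigr => j _; have jz := ltn_ord j.
  have -> : (z - j + (e + 1) = z + e - j + 1)%N by lia.
  rewrite -mul2n /acoef.
  have [tj|jt] := leqP t j; last by rewrite stirling2_small // !(muln0, mul0n) mul0r.
  have -> : (2 ^ j = 2 ^ (j - t) * 2 ^ t)%N by rewrite -expnD subnK.
  rewrite !natrM.
  have t0 : (t`!)%:R != 0 :> rat by rewrite pnatr_eq0 -lt0n fact_gt0.
  have b0 : ((m - 2 * t)`!)%:R != 0 :> rat by rewrite pnatr_eq0 -lt0n fact_gt0.
  have p0 : (2 ^ t)%:R != 0 :> rat by rewrite pnatr_eq0 -lt0n expn_gt0.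
  move: ((t`!)%:R) (((m - 2 * t)`!)%:R) ((2 ^ t)%:R) t0 b0 p0 => a b c a0 b0 c0.
  by field; rewrite a0 b0 c0.
rewrite natr_sum [LHS]big_nat [RHS]big_nat; apply: eq_bigr => j /andP[_ jz].
rewrite natrM natr_sum mulr_sumr.
rewrite (sum_nat_trunc (a := (minn j ((m - 1) %/ 2)).+1)).
- by apply: eq_bigr => t _; rewrite natrM.
- by rewrite ltnS; lia.
(* The dropped terms vanish: either t > j, or m = 2t and the involution has no fixed point to
   receive the odd orbit of [None]. *)
- move=> t /andP[lo hi].
  have [tj|jt] := leqP t j; last by rewrite /acoef (stirling2_small jt) muln0 mul0n muln0.
  have -> : (m - 2 * t = 0)%N by lia.
  by rewrite stirling2_0r addn1 !muln0.
Qed.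

Variable T : finType.
Implicit Types (A : {set T}) (S : binop T).

Definition fixed_over A : nat :=
  \sum_(p : bool * {perm T})
    #|[set S | [&& nilpotent3 S, prods S == ~: A, moves p.1 p.2 S S
                 & fixes_prods p.1 p.2 S]]|.

Lemma restricted_fixedE : restricted_fixed T = \sum_(A : {set T}) fixed_over A.
Proof.
rewrite exchange_big /restricted_fixed /=.
under eq_bigr => S _ do rewrite -sum1dep_card.
rewrite (exchange_big_dep predT) //=; apply: eq_bigr => p _.
rewrite (partition_big (fun S => ~: prods S) predT) //=; apply: eq_bigr => A _.
rewrite sum1dep_card; apply: eq_card => S; rewrite !inE.
rewrite (can2_eq (@setCK _) (@setCK _)) -andbA; congr (_ && _).
by rewrite andbC.
Qed.

(** S^2 has at least two elements, and if [A] were empty every product would be the zero. *)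
Lemma fixed_over_out A : ~~ (0 < #|A| < #|T|.-1)%N -> fixed_over A = 0%N.
Proof.
move=> out; apply: big1 => p _; apply/eqP; rewrite cards_eq0; apply/eqP/setP => S.
rewrite !inE; apply/negP => /and4P[/nilpotent3P[o ho [oS cS]] /eqP sq _ _].
move/negP: out; apply; apply/andP; split; last first.
  by move: cS; rewrite sq; have := cardsC A; lia.
rewrite lt0n; apply/negP; rewrite cards_eq0 => /eqP A0.
move: cS; rewrite ltnNge => /negP; apply; rewrite -(cards1 o).
apply/subset_leq_card/subsetP => _ /prodsP[x [y ->]]; rewrite inE ho //.
by rewrite sq A0 setC0 inE.
Qed.

Definition fixes_out b (f : {perm T}) A :=
  [forall (y | y \in ~: A), (if b then f (f y) else f y) == y].

(** A permutation fixing S preserves S^2, hence its complement [A]; those not stabilising [A]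
    contribute nothing. *)
Lemma fixed_over_split A : fixed_over A =
  (\sum_(b : bool) \sum_(g : {perm T} | perm_on A g) \sum_(s : {perm T} | perm_on (~: A) s)
    if fixes_out b (g * s)%g A then
      #|[set S | [&& nilpotent3 S, prods S == ~: A & iso_by (g * s)%g (twist b S) S]]|
    else 0)%N.
Proof.
rewrite /fixed_over -(pair_bigA _ (fun b f => #|[set S | [&& nilpotent3 S,
   prods S == ~: A, moves b f S S & fixes_prods b f S]]|)) /=; apply: eq_bigr => b _.
have := sum_perm_split (fun f => if fixes_out b f A then
  #|[set S | [&& nilpotent3 S, prods S == ~: A & iso_by f (twist b S) S]]| else 0%N) (subsetT A).
rewrite setTD => <-.
rewrite [RHS]big_mkcond; apply: eq_bigr => f _.
have -> /= : perm_on setT f by apply/subsetP => x; rewrite inE.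
case: ifPn => st; last first.
  apply/eqP; rewrite cards_eq0; apply/eqP/setP => S; rewrite !inE.
  apply/negP => /and4P[_ /eqP sq m _]; move/negP: st; apply; apply/stableP => x.
  by apply: contraLR; rewrite -!in_setC -sq (moves_prods _ m).
case: ifPn => fx.
  apply: eq_card => S; rewrite !inE; case: (nilpotent3 S) => //=.
  by case: eqP => //= sq; rewrite /fixes_prods sq -/(fixes_out b f A) fx andbT.
apply/eqP; rewrite cards_eq0; apply/eqP/setP => S; rewrite !inE.
by apply/negP => /and4P[_ /eqP sq _]; rewrite /fixes_prods sq -/(fixes_out b f A) (negbTE fx).
Qed.

Lemma perm_Enum n r l1 l2 : perm_eq l1 l2 -> Enum n r l1 = Enum n r l2.
Proof.
by move=> pl; rewrite /Enum (perm_beta pl) (perm_zeta pl) (perm_eta pl).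
Qed.

Lemma fixed_over_psum A : (0 < #|A| < #|T|.-1)%N ->
  (fixed_over A)%:R = (#|~: A|`! * #|A|`!)%:R *
    psum #|A| (fun lam => (Enum #|T| #|A| lam)%:R).
Proof.
move=> cA; have cC := cardsC A.
have c1 : (1 < #|~: A|)%N by lia.
have m0 : (0 < #|~: A|)%N by lia.
have cm : #|~: A| = (#|T| - #|A|)%N by lia.
rewrite natrM -mulrA -sum_perm_cycle_type; last first.
  by move=> l1 l2 pl; rewrite (perm_Enum _ _ pl).
rewrite fixed_over_split big_bool /= natrD addrC mulr_sumr !natr_sum -big_split /=.
apply: eq_bigr => g gA; rewrite /Enum natrD mulrDr -cm; congr (_ + _).
  (* Automorphisms must fix S^2 pointwise, so only the trivial [s] remains. *)
  rewrite (bigD1 1%g) ?perm_on1 //= big1 ?addn0 => [|s /andP[sA s1]].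
    have fx : fixes_out false (g * 1)%g A.
      apply/forall_inP => y; rewrite inE mulg1 => yA.
      by rewrite (out_perm gA).
    rewrite fx card_automorphic ?perm_on1 ?natrM // => y yA.
    by apply/eqP; have /forall_inP/(_ y yA) := fx.
  case: ifP => // /forall_inP fx; case/eqP: s1; apply/permP => y; rewrite perm1.
  have [yA|yA] := boolP (y \in ~: A); last by rewrite (out_perm sA).
  by have := fx y yA; rewrite permM (out_perm gA) ?(eqP _) //; [move/eqP | rewrite inE in yA].
(* For anti-automorphisms [s] ranges over the involutions of [~: A]. *)
rewrite -mixed_surj_enum // -(sum_involutions _ (fun t =>
   (mixed_surj (zeta (cycle_type A g)) (eta (cycle_type A g) + 1) (#|~: A| - t.*2) t)%:R)).
rewrite natr_sum [RHS]big_mkcondr; apply: eq_bigr => s sA.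
have out y : y \in ~: A -> (g * s)%g y = s y.
  by rewrite inE => yA; rewrite permM (out_perm gA).
have -> : fixes_out true (g * s)%g A = [forall (y | y \in ~: A), s (s y) == y].
  apply: eq_forallb => y; case yA: (y \in ~: A) => //=.
  by rewrite !out // perm_closed.
case: ifP => // /forall_inP inv; rewrite card_antiautomorphic // => y yA.
by apply/eqP/inv.
Qed.

(** There are C(n, r) sets [A] of size r, and C(n, r) (n-r)! r! = n!. *)
Lemma restricted_fixed_E : (2 < #|T|)%N ->
  (restricted_fixed T)%:R = (2 * #|T|`!)%:R * E #|T|.
Proof.
move=> n3; rewrite restricted_fixedE natr_sum.
pose F r : rat := if (0 < r < #|T|.-1)%N then ((#|T| - r)`! * r`!)%:R *
    psum r (fun lam => (Enum #|T| r lam)%:R) else 0.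
rewrite (eq_bigr (fun A : {set T} => F #|A|)) => [|A _]; last first.
  rewrite /F; case: ifPn => [cA|/fixed_over_out-> //]; rewrite fixed_over_psum //.
  by have -> : #|~: A| = (#|T| - #|A|)%N by have := cardsC A; lia.
rewrite (eq_bigl (fun A => A \subset [set: T])); last by move=> A; rewrite subsetT.
rewrite sum_powerset_card cardsT -(big_mkord predT (fun i => F i *+ 'C(#|T|, i))).
(* The sizes 0, n-1 and n contribute nothing, which leaves the range of r in [E]. *)
rewrite big_ltn // {1}/F /= mul0rn add0r (sum_nat_trunc (a := #|T|.-1)); last 2 first.
- by rewrite -subn1 subn_gt0 (ltnW n3) (leq_trans (leq_subr _ _)).
- move=> t /andP[lo _]; have -> : F t = 0 by rewrite /F andbC ltnNge lo.
  by rewrite mul0rn.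
rewrite /E mulr_sumr [LHS]big_nat [RHS]big_nat; apply: eq_bigr => r hr.
rewrite /F hr -[LHS]mulr_natl mulrA -natrM /psum !mulr_sumr.
apply: eq_big_seq => lam; rewrite mem_partitions => /and3P[_ pos _].
have rT : (r <= #|T|)%N by lia.
have -> : ('C(#|T|, r) * ((#|T| - r)`! * r`!) = #|T|`!)%N.
  by rewrite [((_ - _)`! * _)%N]mulnC bin_fact.
have w0 : (wt lam)%:R != 0 :> rat by rewrite pnatr_eq0 -lt0n wt_gt0.
by rewrite natrM; field.
Qed.

End Assembly.

Theorem theorem8p9 (n : nat) (hn : (3 <= n)%N) :
  (num_classes (fun S : binop 'I_n => nilpotent3 S && semirigid S))%:R <= E n
  /\ E n <= (num_classes (@nilpotent3 'I_n))%:R.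
Proof.
have n0 : 0 < (2 * n`!)%:R :> rat by rewrite ltr0n muln_gt0 fact_gt0.
have := @restricted_fixed_E 'I_n; rewrite card_ord => /(_ hn) NE.
have lo := restricted_fixed_ge 'I_n; have hi := restricted_fixed_le 'I_n.
rewrite card_ord in lo hi.
split; rewrite -(ler_pM2l n0) -NE -natrM ler_nat mulnC.
  exact: lo.
exact: hi.
Qed.
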